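(* Let $k\in\mathbb N$, $\mathbf y\in\mathbb R^k$, $N\in\mathbb N$ and $\mathbf d=(d_1,\dots,d_k)\in(0,1/2]^k$, and for each integer $n\in[N,2N)$ let $A_n^*(\cdot)=A_n^*(\cdot;\mathbf d)$. Let $\mu=\mu_1\times\cdots\times\mu_k$ be a product of Borel probability measures on $[0,1]$ with $\dim_{\ell^1}(\mu_j)=\kappa_j$ for each $j$. Then for any $\varepsilon>0$, \[ \Big|\sum_{N\leqslant n<2N}\big(\mu(A_n^* )-\lambda(A_n^* )\big)\Big|\ll_{\varepsilon} N^{k+\varepsilon}\prod_{j=1}^k d_j^{\kappa_j-\varepsilon}, \] where the implied constant depends on $\varepsilon,k,w,\mu$ but not on $N$, $\mathbf d$ or $\mathbf y$.
   Context: Let $w:\mathbb R\to[0,1]$ be a fixed non-zero smooth (Schwartz-class) bump function supported on $[-2,2]$. For $\mathbf d\in(0,1/2]^k$ put $w_{\mathcal R(\mathbf d)}(\mathbf x)=\prod_{j=1}^k w(x_j/d_j)$, and for $n\in\mathbb N$ and fixed $\mathbf y\in\mathbb R^k$ define \[ A_n^*(\mathbf x;\mathbf d)=\sum_{\mathbf a\in\mathbb Z^k}w_{\mathcal R(\mathbf d)}\Big(\mathbf x-\frac{\mathbf a+\mathbf y}{n}\Big). \] $\lambda$ is Lebesgue measure on $[0,1]^k$ and $\nu(f)=\int_{[0,1]^k}f\,d\nu$. For a Borel probability measure $\nu$ on $[0,1]$, $\hat\nu(\xi)=\int e^{-2\pi i\xi x}\,d\nu(x)$ and $\dim_{\ell^1}(\nu)=\sup\{s\geqslant0:\sum_{\xi\in\mathbb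 Z,|\xi|\leqslant Q}|\hat\nu(\xi)|\ll Q^{1-s}\ (Q\geqslant1)\}$. *)

(* Defs.v *)
From HB Require Import structures.
From mathcomp Require Import all_boot all_order all_algebra.
From mathcomp Require Import all_classical all_reals all_analysis.
Set Implicit Arguments. Unset Strict Implicit. Unset Printing Implicit Defensive.
Import Order.TTheory GRing.Theory Num.Theory.
Import numFieldNormedType.Exports.
Local Open Scope classical_set_scope.
Local Open Scope ring_scope.

Section Defs.
Variable R : realType.

Definition smooth (f : R -> R) : Prop :=
  forall (n : nat) (x : R), derivable (iter n (@derive1 R R) f) x 1.

(* |hat nu (xi)| with hat nu(xi) = int e^{-2 pi i xi x} dnu(x),
   written via real and imaginary parts *)
Definition abs_fourier (nu : {measure set (measurableTypeR R) -> \bar R}) (xi : R) : R :=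
  Num.sqrt ((Rintegral nu `[0%R, 1%R] (fun x => cos (2 * pi * xi * x))) ^+ 2
          + (Rintegral nu `[0%R, 1%R] (fun x => sin (2 * pi * xi * x))) ^+ 2).

(* sum over integers xi with |xi| <= Q *)
Definition l1_fourier_sum (nu : {measure set (measurableTypeR R) -> \bar R}) (Q : R) : R :=
  let M := Num.truncn Q in
  \sum_(0 <= i < (2 * M).+1) abs_fourier nu (i%:R - M%:R).

Definition l1dim (nu : {measure set (measurableTypeR R) -> \bar R}) : R :=
  sup [set s : R | 0 <= s /\
     exists C : R, forall Q : R, 1 <= Q -> l1_fourier_sum nu Q <= C * Q `^ (1 - s)].

Definition Astar (k : nat) (w : R -> R) (y d : nat -> R) (n : nat)
  (x : nat -> R) : \bar R :=
  (\esum_(a in [set: {ffun 'I_k -> int}])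
     (\prod_(j < k) w ((x j - ((a j)%:~R + y j) / n%:R) / d j))%:E)%E.

(* iterated integral over [0,1]^k w.r.t. mu_0 x ... x mu_{m-1}
   (coordinates 0..m-1 are integrated) *)
Fixpoint iter_int (mu : nat -> {measure set (measurableTypeR R) -> \bar R}) (m : nat)
  (f : (nat -> R) -> \bar R) : (nat -> R) -> \bar R :=
  match m with
  | 0 => f
  | m'.+1 => iter_int mu m' (fun x =>
       (\int[mu m']_(t in `[0%R, 1%R]) f (fun i => if i == m' then t else x i))%E)
  end.

(* nu(f) = int_{[0,1]^k} f dnu for the product measure nu = mu_0 x ... x mu_{k-1} *)
Definition prod_int (mu : nat -> {measure set (measurableTypeR R) -> \bar R}) (k : nat)
  (f : (nat -> R) -> \bar R) : \bar R :=
  iter_int mu k f (fun _ => 0).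

Definition leb_int (k : nat) (f : (nat -> R) -> \bar R) : \bar R :=
  prod_int (fun _ => (@lebesgue_measure R : {measure set (measurableTypeR R) -> \bar R})) k f.

End Defs.

(* Main.v *)
Require Import Defs.
From HB Require Import structures.
From mathcomp Require Import all_boot all_order all_algebra.
From mathcomp Require Import all_classical all_reals all_analysis.
From mathcomp Require Import measurable_realfun ring lra zify.
Import Order.TTheory GRing.Theory Num.Theory.
Import numFieldNormedType.Exports.
Local Open Scope classical_set_scope.
Local Open Scope ring_scope.

Set Implicit Arguments.
Unset Strict Implicit.
Unset Printing Implicit Defensive.

(** After the change of variable [u = n x - y], the lattice sum in one coordinate
    is the 1-periodization of [w (u / delta)] with [delta = n d]. Instead of
    using Poisson summation, sample the periodization at the points [s / q] and
    convolve with the Fejér kernel of order [M <= q / 2]. This gives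
    trigonometric polynomials that converge uniformly to the periodization, and
    summation by parts (twice) bounds their [m]-th coefficients by
    [O(delta min(1, (delta m)^-2))], uniformly in [M] and [q].
    Integrating against a probability measure [nu] on the unit interval, only
    the frequencies [x = n m] of [nu] occur; the zeroth coefficient is common to
    [nu] and to Lebesgue measure, for which all the other terms vanish.
    When [n] runs over [N <= n < 2 N], a frequency [x <> 0] is hit at most
    [tau(x) = O(x^e)] times, and a dyadic decomposition according to the size of
    [d x] bounds the resulting sum in terms of the l1-dimension of [nu].
    Both k-dimensional integrals are products of one-dimensional ones, so that
    their difference telescopes. *)

(** * The divisor bound *)

(** Splitting off the [p]-part writes each divisor as [e * p ^ i] with [e] dividing [m] and
    [i <= a], so the list of these products contains every divisor. *)
Lemma size_divisorsM (p a m : nat) : prime p -> coprime p m -> (0 < m)%N ->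
  (size (divisors (m * p ^ a)) <= a.+1 * size (divisors m))%N.
Proof.
move=> pp cpm m0.
have n0 : (0 < m * p ^ a)%N by rewrite muln_gt0 m0 expn_gt0 prime_gt0.
rewrite -(size_iota 0 a.+1) -(size_allpairs (fun i e => e * p ^ i)%N).
apply: uniq_leq_size; first exact: divisors_uniq.
move=> d; rewrite -dvdn_divisors // => dn.
have d0 : (0 < d)%N by exact: dvdn_gt0 dn.
have [e cpe de] := pfactor_coprime pp d0.
apply/allpairsP; exists (logn p d, e); split => //.
- rewrite mem_iota add0n ltnS /=.
  have := dvdn_leq_log p n0 dn.
  by rewrite (lognM _ m0) ?expn_gt0 ?prime_gt0 // (logn_coprime cpm) pfactorK.
- rewrite -dvdn_divisors //=.
  have : (e %| m * p ^ a)%N by apply: dvdn_trans dn; rewrite de dvdn_mulr.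
  by rewrite Gauss_dvdl // coprime_sym coprimeXl.
Qed.

(** From [1 + x <= expR x] at [x = a e ln 2]; the term [(e ln 2)^-1] in [c] turns the linear part
    into [a]. *)
Lemma leS_powR2 (R : realType) (e : R) : 0 < e ->
  exists2 c : R, 1 <= c & forall a : nat, a.+1%:R <= c * 2 `^ (a%:R * e).
Proof.
move=> e0; have l2 : 0 < ln (2 : R) by rewrite ln_gt0 // ltr1n.
have el : 0 < e * ln 2 by rewrite mulr_gt0.
exists (1 + (e * ln 2)^-1) => [|a]; first by rewrite lerDl invr_ge0 ltW.
rewrite /powR pnatr_eq0 /= -mulrA.
have h := expR_ge1Dx (a%:R * (e * ln 2) : R).
apply: le_trans (ler_wpM2l _ h); last by rewrite addr_ge0 // invr_ge0 ltW.
rewrite mulrDl mul1r mulrDr mulr1 [_^-1 * _]mulrC -mulrA mulfV ?gt_eqF // mulr1 -natr1.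
have : 0 <= (e * ln 2)^-1 by rewrite invr_ge0 ltW.
have : 0 <= a%:R * (e * ln 2) by rewrite mulr_ge0 // ltW.
lra.
Qed.

(* Large primes p (those with p ^ e >= 2) satisfy a + 1 <= 2 ^ a <= p ^ (a e);
   each of the boundedly many small primes costs a factor c. *)
Lemma divisor_bound (R : realType) (e : R) : 0 < e ->
  exists2 C : R, 0 <= C & forall n : nat, (0 < n)%N ->
    (size (divisors n))%:R <= C * n%:R `^ e.
Proof.
move=> e0; have [c c1 hc] := leS_powR2 e0.
have c0 : 0 <= c by apply: le_trans c1.
pose P := (Num.truncn (2 `^ e^-1 : R)).+1.
have hP (p : nat) : (P <= p)%N -> 2 <= p%:R `^ e.
  move=> Pp.
  have -> : 2 = (2 `^ e^-1 : R) `^ e by rewrite -powRrM mulVf ?gt_eqF // powRr1.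
  apply: ge0_ler_powR; rewrite ?nnegrE ?powR_ge0 ?ler0n ?ltW //.
  have h : (2 `^ e^-1 : R) < P%:R by rewrite /P truncnS_gt.
  by apply: lt_le_trans h _; rewrite ler_nat.
have key n : (0 < n)%N ->
  (size (divisors n))%:R <= c ^+ (count (fun p => (p < P)%N) (primes n)) * n%:R `^ e.
  elim/ltn_ind: n => n IH n0.
  have [->|n1] := eqVneq n 1%N.
    by rewrite (_ : divisors 1 = [:: 1%N]) //= expr0 mul1r powR1.
  have n2 : (1 < n)%N by rewrite ltn_neqAle eq_sym n1.
  pose p := pdiv n; have pp : prime p by exact: pdiv_prime.
  have [m cpm nE] := pfactor_coprime pp n0.
  set a := logn p n in nE.
  have a0 : (0 < a)%N by rewrite logn_gt0 pi_pdiv.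
  have m0 : (0 < m)%N by move: n0; rewrite nE muln_gt0 => /andP[].
  have mn : (m < n)%N.
    rewrite nE -{1}(muln1 m) ltn_pmul2l // -(exp1n a) ltn_exp2r //; exact: prime_gt1.
  have pm : p \notin primes m.
    by rewrite mem_primes m0 pp /= -prime_coprime // .
  have prm : perm_eq (primes n) (p :: primes m).
    apply: uniq_perm; rewrite /= ?primes_uniq ?pm //.
    move=> r; rewrite nE primesM // ?expn_gt0 ?prime_gt0 // primesX // (primes_prime pp).
    by rewrite !inE orbC.
  rewrite (permP prm) /= exprD.
  have h1 : (size (divisors n))%:R <= a.+1%:R * (size (divisors m))%:R :> R.
    by rewrite -natrM ler_nat {1}nE size_divisorsM.
  apply: le_trans h1 _.
  have -> : n%:R `^ e = p%:R `^ (a%:R * e) * m%:R `^ e :> R.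
    rewrite {1}nE natrM powRM // mulrC natrX powRrM -powR_mulrn //.
  rewrite mulrACA; apply: ler_pM => //; last exact: IH.
  have [lp|lp] /= := ltnP p P.
    rewrite expr1; apply: le_trans (hc a) _; rewrite ler_wpM2l //.
    apply: ge0_ler_powR; rewrite ?nnegrE ?ler0n ?(mulr_ge0 _ (ltW e0)) // ler_nat.
    exact: prime_gt1.
  rewrite expr0 mul1r mulrC powRrM powR_mulrn ?powR_ge0 //.
  apply: (@le_trans _ _ (2 ^+ a)); last by apply: lerXn2r; rewrite ?nnegrE ?powR_ge0 ?hP.
  by rewrite -natrX ler_nat ltn_expl.
exists (c ^+ P); first exact: exprn_ge0.
move=> n n0; apply: le_trans (key n n0) _.
rewrite ler_wpM2r ?powR_ge0 //; apply: ler_weXn2l => //.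
rewrite -size_filter -[leqRHS](size_iota 0 P); apply: uniq_leq_size.
  by rewrite filter_uniq // primes_uniq.
by move=> p; rewrite mem_filter mem_iota leq0n add0n => /andP[].
Qed.

(** * Dyadic decomposition of weighted sums *)

Section DyadicWeights.
Variable R : realType.
Implicit Types (a : nat -> R) (u d e s C D : R).

(** If [4 ^ I < u <= 4 ^ (I + 1)], then [u ^ e <= 2 ^ (I + 1)] because [e <= 1/2], and
    [u ^ -2 <= 16 ^ -I]; the product is 16 times the weight [8 ^ -(I + 1)] of the last layer.
    Indicators replace a case split on [u], so that sums over [u] can be taken layer by layer. *)
Lemma powR_min_le_dyadic u e (I : nat) : 0 < u -> 0 < e <= 2^-1 -> u <= 4 ^+ I ->
  u `^ e * Num.min 1 (u ^- 2) <=
  16 * \sum_(0 <= i < I.+1) (8^-1 ^+ i * (u <= 4 ^+ i)%R%:R).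
Proof.
move=> u0 /andP[e0 e1].
have t0 (i : nat) : 0 <= 8^-1 ^+ i * (u <= 4 ^+ i)%R%:R :> R.
  by rewrite mulr_ge0 ?exprn_ge0 ?ler0n ?invr_ge0.
have s0 (n : nat) : 0 <= \sum_(0 <= i < n) (8^-1 ^+ i * (u <= 4 ^+ i)%R%:R) :> R.
  by apply: sumr_ge0 => i _.
have m0 : 0 <= Num.min 1 (u ^- 2) by rewrite le_min ler01 invr_ge0 exprn_ge0 // ltW.
elim: I => [|I IH] uI.
  rewrite big_nat1 expr0 mul1r uI mulr1.
  rewrite expr0 in uI.
  have h : u `^ e <= 1 by rewrite -(powRr0 u); apply: ger_powR; rewrite ?u0 //= ltW.
  apply: (@le_trans _ _ (1 * 1)); last by lra.
  by apply: ler_pM => //; rewrite ?powR_ge0 ?m0 // ge_min lexx.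
rewrite big_nat_recr //= mulrDr.
have [le|lt] := leP u (4 ^+ I).
  by apply: le_trans (IH le) _; rewrite lerDl mulr_ge0.
apply: (@le_trans _ _ (16 * (8^-1 ^+ I.+1 * (u <= 4 ^+ I.+1)%R%:R))); last first.
  by rewrite lerDr mulr_ge0.
rewrite uI mulr1.
have u1 : 1 <= u.
  by apply: le_trans (ltW lt); apply: exprn_ege1; lra.
have hu : u `^ e <= 2 ^+ I.+1.
  apply: (@le_trans _ _ (u `^ 2^-1)); first exact: ler_powR.
  rewrite powR12_sqrt ?(ltW u0) //.
  have -> : 2 ^+ I.+1 = Num.sqrt ((2 ^+ I.+1) ^+ 2) :> R by rewrite sqrtr_sqr ger0_norm ?exprn_ge0.
  apply: ler_wsqrtr; rewrite exprAC (_ : 2 ^+ 2 = 4 :> R) //; lra.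
have hi : u ^- 2 <= 16^-1 ^+ I.
  rewrite exprVn lef_pV2 ?posrE ?exprn_gt0 //.
  have -> : 16 ^+ I = (4 ^+ I) ^+ 2 :> R.
    by rewrite exprAC (_ : 4 ^+ 2 = 16 :> R) //; lra.
  by apply: lerXn2r; rewrite ?nnegrE ?exprn_ge0 ?ltW.
apply: (@le_trans _ _ (2 ^+ I.+1 * 16^-1 ^+ I)).
  apply: ler_pM => //; rewrite ?powR_ge0 //.
  by rewrite ge_min hi orbT.
have -> : 8^-1 = 2 * 16^-1 :> R by lra.
rewrite exprMn [16^-1 ^+ _.+1]exprS; set x := _ ^+ I.+1; set y := _ ^+ I.
by rewrite (_ : 16 * _ = x * y) //; lra.
Qed.

Lemma sum_geom_half_le (n : nat) : \sum_(0 <= i < n) (2^-1 : R) ^+ i <= 2.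
Proof.
suff -> : \sum_(0 <= i < n) (2^-1 : R) ^+ i = 2 - 2 * 2^-1 ^+ n.
  by rewrite gerBl mulr_ge0 ?exprn_ge0 ?invr_ge0.
elim: n => [|n IH]; first by rewrite big_nil expr0; lra.
by rewrite big_nat_recr //= IH exprS; lra.
Qed.

(** Put [u = d x] in the dyadic bound. Layer [i] becomes a partial sum of [a] up to [4 ^ i / d], at
    most [C (4 ^ i / d) ^ (1 - s)]. As [s >= 0], the powers of 4 cost at most [4 ^ i], and the
    weight [8 ^ -i] leaves a geometric series of ratio 1/2. Hence 32 = 16 * 2; rewriting [x ^ e]
    through [d x] costs [d ^ (- e)]. *)
Lemma weighted_sum_le a C s d e (X : nat) :
  (forall n, 0 <= a n) -> 0 <= s -> 0 < d <= 1 -> 0 < e <= 2^-1 ->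
  (forall Q : R, 1 <= Q -> \sum_(1 <= i < (Num.truncn Q).+1) a i <= C * Q `^ (1 - s)) ->
  \sum_(1 <= x < X.+1) (x%:R `^ e * Num.min 1 ((d * x%:R) ^- 2) * a x)
    <= 32 * C * d `^ (s - e - 1).
Proof.
move=> a0 s0 /andP[d0 d1] he hC.
have [e0 e1] := andP he.
have C0 : 0 <= C.
  have := hC 1 (lexx _); rewrite powR1 mulr1; apply: le_trans.
  exact: sumr_ge0.
(* A generous number of layers: [d x <= x <= X <= 4 ^ X]. *)
pose I := X.
have XI (x : nat) : (x < X.+1)%N -> d * x%:R <= 4 ^+ I.
  move=> xX; apply: (@le_trans _ _ (1 * x%:R)); first by rewrite ler_wpM2r.
  rewrite mul1r -natrX ler_nat; apply: leq_trans (ltnW (ltn_expl I _)) => //.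
pose b (i : nat) (x : nat) : R := 8^-1 ^+ i * (d * x%:R <= 4 ^+ i)%R%:R.
apply: (@le_trans _ _ (\sum_(1 <= x < X.+1) \sum_(0 <= i < I.+1) (d `^ (- e) * 16 * (b i x * a x)))).
  apply: ler_sum_nat => x /andP[x1 xX].
  have x0 : 0 < x%:R :> R by rewrite ltr0n.
  rewrite -mulr_sumr -mulr_suml !mulrA ler_wpM2r //.
  have -> : x%:R `^ e = d `^ (- e) * (d * x%:R) `^ e.
    by rewrite (powRM _ (ltW d0) (ltW x0)) powRN mulrA mulVf ?mul1r // gt_eqF ?powR_gt0.
  rewrite -!mulrA ler_wpM2l ?powR_ge0 //.
  by apply: powR_min_le_dyadic; rewrite ?mulr_gt0 ?XI.
rewrite exchange_big_nat /=.
apply: (@le_trans _ _ (\sum_(0 <= i < I.+1) (d `^ (- e) * 16 * C * d `^ (s - 1) * 2^-1 ^+ i))); last first.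
  rewrite -mulr_sumr; apply: le_trans (ler_wpM2l _ (sum_geom_half_le _)) _.
    by rewrite !mulr_ge0 ?powR_ge0.
  have -> : d `^ (s - e - 1) = d `^ (- e) * d `^ (s - 1).
    rewrite -powRD ?(gt_eqF d0) ?implybT //; congr (_ `^ _); lra.
  set x := d `^ (- e); set y := d `^ (s - 1); lra.
apply: ler_sum_nat => i _; rewrite -mulr_sumr -!mulrA ler_wpM2l ?powR_ge0 // ler_wpM2l //.
have Q1 : 1 <= 4 ^+ i / d.
  by rewrite ler_pdivlMr // mul1r; apply: le_trans d1 _; apply: exprn_ege1; lra.
have := hC _ Q1; set Q := 4 ^+ i / d => hQ.
have h1 : \sum_(1 <= x < X.+1) b i x * a x <= 8^-1 ^+ i * \sum_(1 <= x < (Num.truncn Q).+1) a x.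
  have -> : \sum_(1 <= x < X.+1) b i x * a x =
      8^-1 ^+ i * \sum_(1 <= x < X.+1 | d * x%:R <= 4 ^+ i) a x.
    rewrite [X in _ * X]big_mkcond mulr_sumr; apply: eq_bigr => x _.
    by rewrite /b -mulrA; case: ifP => _; rewrite ?mul1r ?mul0r.
  rewrite ler_wpM2l ?exprn_ge0 ?invr_ge0 //.
  (* [X] and the cutoff at [Q] come in no fixed order, so both ranges are embedded in [[1, Y]];
     beyond [Q] the indicator vanishes. *)
  pose Y := maxn X (Num.truncn Q).
  apply: (@le_trans _ _ (\sum_(1 <= x < Y.+1 | d * x%:R <= 4 ^+ i) a x)).
    rewrite (@big_cat_nat _ _ _ X.+1 1 Y.+1) //= ?ltnS ?leq_maxl // lerDl.
    exact: sumr_ge0.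
  rewrite (@big_cat_nat _ _ _ (Num.truncn Q).+1 1 Y.+1) //= ?ltnS ?leq_maxr //.
  rewrite [X in _ + X]big1_seq ?addr0.
    by rewrite big_mkcond; apply: ler_sum => x _; case: ifP.
  move=> x /andP[dx]; rewrite mem_index_iota => /andP[tx _].
  have := truncnS_gt Q; rewrite ltNge => /negP[].
  apply: (@le_trans _ _ x%:R); first by rewrite ler_nat.
  by rewrite /Q ler_pdivlMr // mulrC.
apply: le_trans h1 _.
apply: le_trans (ler_wpM2l _ hQ) _; first by rewrite exprn_ge0 ?invr_ge0.
rewrite mulrCA ler_wpM2l //.
have i4 : 1 <= 4 ^+ i :> R by apply: exprn_ege1; lra.
rewrite /Q powRM ?invr_ge0 ?exprn_ge0 ?(ltW d0) //.
have -> : d^-1 `^ (1 - s) = d `^ (s - 1).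
  by rewrite -(powR_inv1 (ltW d0)) -powRrM mulN1r opprB.
rewrite mulrA mulrC ler_wpM2l ?powR_ge0 //.
apply: (@le_trans _ _ (8^-1 ^+ i * 4 ^+ i)).
  rewrite ler_wpM2l ?exprn_ge0 ?invr_ge0 //; apply: ler1_powR => //; lra.
by rewrite -exprMn (_ : 8^-1 * 4 = 2^-1 :> R) //; lra.
Qed.

End DyadicWeights.

(** * Fourier coefficients of measures on the unit interval *)

Section UnitIntervalIntegral.
Variables (R : realType) (nu : {measure set (measurableTypeR R) -> \bar R}).
Hypothesis nu1 : nu `[0%R, 1%R]%classic = 1%E.
Implicit Types f g : R -> R.

Lemma continuous_itv01_integrable f : continuous f ->
  nu.-integrable `[0%R, 1%R] (EFin \o f).
Proof.
move=> cf; apply: measurable_bounded_integrable => //.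
- by rewrite nu1 ltry.
- by apply: measurable_funTS; exact: continuous_measurable_fun.
- have cn : {within `[0%R, 1%R], continuous (fun x => `|f x|)}.
    apply: continuous_subspaceT => x.
    exact: (continuous_comp (cf x) (@norm_continuous _ _ _)).
  have [c _ hc] := EVT_max (@ler01 R) cn.
  exists `|f c|; split; rewrite ?num_real // => b cb x xA.
  exact: le_trans (hc x xA) (ltW cb).
Qed.

Lemma Rintegral_itv01_norm_le f (b : R) : continuous f ->
  (forall x, 0 <= x <= 1 -> `|f x| <= b) -> `|Rintegral nu `[0%R, 1%R] f| <= b.
Proof.
move=> cf fb.
have cn : continuous (fun x => `|f x|).
  move=> x; exact: (continuous_comp (cf x) (@norm_continuous _ _ _)).
apply: le_trans (le_normr_Rintegral _ (continuous_itv01_integrable cf)) _ => //.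
have -> : b = Rintegral nu `[0%R, 1%R] (fun=> b).
  by rewrite Rintegral_cst // nu1 mulr1.
apply: le_Rintegral => //.
- exact: (continuous_itv01_integrable cn).
- by apply: (@continuous_itv01_integrable (fun=> b)) => x; exact: cvg_cst.
Qed.

Lemma Rintegral_itv01_sum (I : Type) (r : seq I) (F : I -> R -> R) :
  (forall i, continuous (F i)) ->
  Rintegral nu `[0%R, 1%R] (fun x => \sum_(i <- r) F i x) =
  \sum_(i <- r) Rintegral nu `[0%R, 1%R] (F i).
Proof.
move=> cF; elim: r => [|i r IH].
  rewrite big_nil -[RHS](mul0r (fine (nu `[0%R, 1%R]%classic))) -Rintegral_cst //.
  by congr Rintegral; apply/funext => x; rewrite big_nil.
rewrite big_cons -IH -RintegralD //.
- by congr Rintegral; apply/funext => x; rewrite big_cons.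
- exact: continuous_itv01_integrable.
- apply: continuous_itv01_integrable => x.
  by apply: (@continuous_big _ _ _ _ _ _ _) => //; apply: add_continuous.
Qed.

Lemma abs_fourier_ge0 xi : 0 <= abs_fourier nu xi.
Proof. exact: sqrtr_ge0. Qed.

Lemma continuous_cosZ (c b : R) : continuous (fun x : R => cos (c * x + b)).
Proof.
move=> x; apply: (@continuous_comp _ _ _ (fun x : R => c * x + b) cos).
  by apply: cvgD; [apply: cvgMr; exact: cvg_id|exact: cvg_cst].
exact: continuous_cos.
Qed.

Lemma continuous_sinZ (c : R) : continuous (fun x : R => sin (c * x)).
Proof.
move=> x; apply: (@continuous_comp _ _ _ (fun x : R => c * x) sin).
  by apply: cvgMr; exact: cvg_id.
exact: continuous_sin.
Qed.

Lemma norm_Rintegral_cos_le xi :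
  `|Rintegral nu `[0%R, 1%R] (fun x => cos (2 * pi * xi * x))| <= abs_fourier nu xi.
Proof. by rewrite /abs_fourier -sqrtr_sqr ler_wsqrtr // lerDl sqr_ge0. Qed.

Lemma norm_Rintegral_sin_le xi :
  `|Rintegral nu `[0%R, 1%R] (fun x => sin (2 * pi * xi * x))| <= abs_fourier nu xi.
Proof. by rewrite /abs_fourier -sqrtr_sqr ler_wsqrtr // lerDr sqr_ge0. Qed.

Lemma abs_fourier0 : abs_fourier nu 0 = 1.
Proof.
rewrite /abs_fourier.
under eq_Rintegral do rewrite mulr0 mul0r cos0.
under [X in _ + X ^+ 2]eq_Rintegral do rewrite mulr0 mul0r sin0.
by rewrite !Rintegral_cst // nu1 /= mul1r mul0r expr1n expr0n addr0 sqrtr1.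
Qed.

Lemma abs_fourier_le2 xi : abs_fourier nu xi <= 2.
Proof.
rewrite /abs_fourier; set a := Rintegral _ _ _; set b := Rintegral _ _ _.
have ha : `|a| <= 1.
  apply: Rintegral_itv01_norm_le => [x|x _]; last exact: cos_max.
  by have := @continuous_cosZ (2 * pi * xi) 0 x; under eq_fun do rewrite addr0.
have hb : `|b| <= 1.
  apply: Rintegral_itv01_norm_le => [|x _]; [exact: continuous_sinZ|exact: sin_max].
rewrite -(@ger0_norm _ 2) // -sqrtr_sqr ler_wsqrtr //.
move: ha hb; rewrite !ler_norml => /andP[? ?] /andP[? ?]; nra.
Qed.

(** Index [i] carries the frequency [i - M]; the pieces are the negative, zero and positive
    frequencies, and the products [n m] only meet the positive ones. *)
Lemma l1_fourier_sum_split (Q : R) : l1_fourier_sum nu Q =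
  \sum_(0 <= i < Num.truncn Q) abs_fourier nu (i%:R - (Num.truncn Q)%:R) +
  (abs_fourier nu 0 + \sum_(1 <= i < (Num.truncn Q).+1) abs_fourier nu i%:R).
Proof.
rewrite /l1_fourier_sum; set M := Num.truncn Q.
rewrite (@big_cat_nat _ _ _ M) //=; last by lia.
congr (_ + _); rewrite big_ltn; last by lia.
rewrite subrr; congr (_ + _).
have -> : (2 * M).+1 = (M.+1 + M)%N by lia.
rewrite -{1}(add1n M) [in LHS]big_addn.
have -> : (M.+1 + M - M = M.+1)%N by lia.
by apply: eq_bigr => i _; rewrite natrD addrK.
Qed.

(** The zeroth coefficient alone contributes 1. This later yields [d <= C d ^ s], a quantitative
    form of the dimension being at most 1. *)
Lemma one_le_l1_fourier_sum (Q : R) : 1 <= l1_fourier_sum nu Q.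
Proof.
rewrite l1_fourier_sum_split abs_fourier0 addrCA lerDl.
by rewrite addr_ge0 //; apply: sumr_ge0 => i _; exact: abs_fourier_ge0.
Qed.

Lemma sum_abs_fourier_le (Q : R) :
  \sum_(1 <= i < (Num.truncn Q).+1) abs_fourier nu i%:R <= l1_fourier_sum nu Q.
Proof.
rewrite l1_fourier_sum_split addrA lerDr addr_ge0 ?abs_fourier_ge0 //.
by apply: sumr_ge0 => i _; exact: abs_fourier_ge0.
Qed.

(* If the defining set of l1dim were unbounded, sup would return 0, and s = 0 still works. *)
Lemma l1dim_approx (e : R) : 0 < e -> exists s C : R, [/\ 0 <= s, l1dim nu - e < s &
  forall Q : R, 1 <= Q -> l1_fourier_sum nu Q <= C * Q `^ (1 - s)].
Proof.
move=> e0; pose S := [set s : R | 0 <= s /\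
     exists C : R, forall Q : R, 1 <= Q -> l1_fourier_sum nu Q <= C * Q `^ (1 - s)].
have S0 : S 0.
  (* Trivial bound: at most [2 Q + 1 <= 3 Q] terms, each at most 2. *)
  split=> //; exists 6 => Q Q1; rewrite subr0 powRr1; last by lra.
  apply: (@le_trans _ _ (\sum_(0 <= i < (2 * Num.truncn Q).+1) 2)).
    by apply: ler_sum => i _; exact: abs_fourier_le2.
  rewrite big_const_nat iter_addr_0 subn0 -[leLHS]mulr_natr -[(_ * _).+1%:R]natr1 natrM.
  have := truncn_le Q; lra.
have [hS|/sup_out hS] := pselect (has_sup S).
  by have [s [s0 [C hC]] hs] := sup_adherent e0 hS; exists s, C; split.
have [s0 [C hC]] := S0; exists 0, C; split => //.
by rewrite /l1dim -/S hS sub0r oppr_lt0.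
Qed.

End UnitIntervalIntegral.

Lemma lebesgue_measure_itv01 (R : realType) :
  @lebesgue_measure R `[0%R, 1%R]%classic = 1%E.
Proof. by rewrite lebesgue_measure_itv /= lte_fin ltr01 sube0. Qed.

Lemma abs_fourier_lebesgue (R : realType) (n : nat) : (0 < n)%N ->
  abs_fourier (@lebesgue_measure R) n%:R = 0.
Proof.
move=> n0; set c : R := 2 * pi * n%:R.
have c0 : c != 0 by rewrite !mulf_neq0 // ?gt_eqF ?pi_gt0 // ltr0n.
have cE : c = 0 + pi *+ 2 *+ n by rewrite add0r -mulrnA -[RHS]mulr_natr natrM /c; ring.
have hs : sin c = 0 by rewrite cE (periodicn (@sinD2pi R)) sin0.
have hc : cos c = 1 by rewrite cE (periodicn (@cosD2pi R)) cos0.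
have dr (f : R -> R) (df : R -> R) : (forall x : R, is_derive x 1 f (df x)) ->
    derivable_oo_LRcontinuous f 0 1.
  move=> hf; have cf : continuous f.
    move=> x; apply: differentiable_continuous; apply/derivable1_diffP.
    by have [] := hf x.
  split; [by move=> x _; have [] := hf x| |].
  - by apply: cvg_at_right_filter; exact: cf.
  - by apply: cvg_at_left_filter; exact: cf.
have i1 : Rintegral (@lebesgue_measure R) `[0%R, 1%R] (fun x => cos (c * x)) = 0.
  have df (x : R) : is_derive x 1 (fun x : R => c^-1 * sin (c * x)) (cos (c * x)).
    by apply: is_derive_eq; rewrite /GRing.scale /=; field.
  rewrite /Rintegral (@continuous_FTC2 _ _ (fun x : R => c^-1 * sin (c * x))) //=.
  - by rewrite mulr1 mulr0 hs sin0 !mulr0 subrr.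
  - apply: continuous_subspaceT => x.
    by have := @continuous_cosZ _ c 0 x; under eq_fun do rewrite addr0.
  - exact: dr df.
  - by move=> x _; rewrite derive1E; have [] := df x.
have i2 : Rintegral (@lebesgue_measure R) `[0%R, 1%R] (fun x => sin (c * x)) = 0.
  have df (x : R) : is_derive x 1 (fun x : R => - c^-1 * cos (c * x)) (sin (c * x)).
    by apply: is_derive_eq; rewrite /GRing.scale /=; field.
  rewrite /Rintegral (@continuous_FTC2 _ _ (fun x : R => - c^-1 * cos (c * x))) //=.
  - by rewrite mulr1 mulr0 hc cos0 !mulr1 subrr.
  - apply: continuous_subspaceT => x; exact: continuous_sinZ.
  - exact: dr df.
  - by move=> x _; rewrite derive1E; have [] := df x.
by rewrite /abs_fourier i1 i2 expr0n addr0 sqrtr0.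
Qed.

(** * Difference bounds for compactly supported smooth functions *)

Section CompactlySupportedSmooth.
Variable R : realType.
Implicit Types (f w : R -> R) (B x y h : R).

Lemma derive1_eq0_outside f : (forall x, 2 < `|x| -> f x = 0) ->
  forall x, 2 < `|x| -> derive1 f x = 0.
Proof.
move=> f0 x x2; rewrite derive1E -(@derive_cst R R R 0 x 1).
apply: near_eq_derive; rewrite ?oner_eq0 //.
near=> y; apply: f0; near: y.
by apply: (@cvgr_gt _ _ _ _ _ `|x|) => //; exact: norm_continuous.
Unshelve. all: by end_near. Qed.

Lemma continuous_bounded_outside f : continuous f -> (forall x, 2 < `|x| -> f x = 0) ->
  exists2 B, 0 <= B & forall x, `|f x| <= B.
Proof.
move=> cf f0.
have cn : {within `[(-2)%R, 2%R], continuous (fun x => `|f x|)}.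
  apply: continuous_subspaceT => x.
  exact: (continuous_comp (cf x) (@norm_continuous _ _ _)).
have le22 : -2 <= 2 :> R by lra.
have [c _ hc] := EVT_max le22 cn.
exists `|f c| => // x; have [x2|x2] := ltP 2 `|x|; first by rewrite f0 // normr0.
by apply: hc; rewrite in_itv /= -ler_norml.
Qed.

Lemma MVT_lipschitz f B : (forall x, derivable f x 1) -> (forall x, `|derive1 f x| <= B) ->
  forall x y, `|f x - f y| <= B * `|x - y|.
Proof.
move=> df fB x y; wlog xy : x y / x <= y => [hw|].
  by have [|/ltW] := leP x y; [exact: hw|rewrite distrC (distrC x); exact: hw].
have cf : {within `[x, y], continuous f}.
  apply: continuous_subspaceT => z.
  by apply: differentiable_continuous; apply/derivable1_diffP.
have dw (z : R) : is_derive z 1 f (derive1 f z).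
  by apply: DeriveDef => //; rewrite -derive1E.
have [c _ e] := MVT_segment xy (fun z _ => dw z) cf.
by rewrite distrC e normrM (distrC x) ler_wpM2r.
Qed.

(** The Lipschitz bound serves the uniform approximation, the second-difference bound the decay of
    the coefficients. For the latter, the mean value theorem on both sides of [x] gives points [a],
    [b] at distance at most [2 h], and the derivative is itself Lipschitz. *)
Lemma smooth_bump_regular w : smooth w -> (forall x, 2 < `|x| -> w x = 0) ->
  exists B, [/\ 0 <= B, forall x y, `|w x - w y| <= B * `|x - y| &
    forall x h, 0 <= h -> `|w (x + h) + w (x - h) - 2 * w x| <= B * h ^+ 2].
Proof.
move=> sw w0.
have w10 := derive1_eq0_outside w0; have w20 := derive1_eq0_outside w10.
have dc (f : R -> R) : (forall x, derivable f x 1) -> continuous f.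
  by move=> df x; apply: differentiable_continuous; apply/derivable1_diffP.
have d0 : forall x, derivable w x 1 := sw 0%N.
have d1 : forall x, derivable (derive1 w) x 1 := sw 1%N.
have d2 : forall x, derivable (derive1 (derive1 w)) x 1 := sw 2%N.
have [B1 B10 hB1] := continuous_bounded_outside (dc _ d1) w10.
have [B2 B20 hB2] := continuous_bounded_outside (dc _ d2) w20.
have l1 := MVT_lipschitz d0 hB1; have l2 := MVT_lipschitz d1 hB2.
exists (B1 + 2 * B2); split; first by lra.
  by move=> x y; apply: le_trans (l1 x y) _; rewrite ler_wpM2r //; lra.
move=> x h h0.
have cw a b : {within `[a, b], continuous w}.
  by apply: continuous_subspaceT => z; exact: dc d0 z.
have dw (z : R) : is_derive z 1 w (derive1 w z).
  by apply: DeriveDef => //; rewrite -derive1E.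
have xh1 : x <= x + h by lra.
have xh2 : x - h <= x by lra.
have [a ha ea] := MVT_segment xh1 (fun z _ => dw z) (cw _ _).
have [b hb eb] := MVT_segment xh2 (fun z _ => dw z) (cw _ _).
have -> : w (x + h) + w (x - h) - 2 * w x = (derive1 w a - derive1 w b) * h.
  have -> : w (x + h) + w (x - h) - 2 * w x = w (x + h) - w x - (w x - w (x - h)) by ring.
  by rewrite ea eb; ring.
rewrite normrM (ger0_norm h0) expr2 mulrA ler_wpM2r //.
apply: le_trans (l2 a b) _.
have : `|a - b| <= 2 * h.
  move: ha hb; rewrite !in_itv /= => /andP[? ?] /andP[? ?].
  by rewrite ler_norml; apply/andP; split; lra.
have := normr_ge0 (a - b); nra.
Qed.

End CompactlySupportedSmooth.

(** * Finitely supported sums over the integers *)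

Section IntegerSums.
Variable R : realType.
Implicit Types (f g : int -> R) (c r b : R).

(* Sum over all integers; it has the value 0 on functions of infinite support. *)
Definition zsum f : R := \sum_(s \in [set: int]) f s.

Lemma zsumE (r : seq int) f : uniq r -> (forall s, s \notin r -> f s = 0) ->
  zsum f = \sum_(s <- r) f s.
Proof.
move=> ur fr; rewrite /zsum (fsbigE r) //; last by move=> s _; exact: fr.
by apply: eq_bigl => s; rewrite in_setT.
Qed.

Lemma zsum_shift f (m : int) : zsum (fun s => f (s + m)) = zsum f.
Proof.
rewrite /zsum (@reindex_fsbigT _ _ _ _ _ (fun s => s + m) f) //.
by exists (fun s => s - m) => s; rewrite ?addrK ?subrK.
Qed.

Definition zwindow (m : int) (L : nat) : seq int := [seq m + i%:Z | i <- iota 0 L].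

Lemma uniq_zwindow m L : uniq (zwindow m L).
Proof. by rewrite map_inj_uniq ?iota_uniq // => i j; lia. Qed.

Lemma mem_zwindow m L s : (s \in zwindow m L) = (m <= s < m + L%:Z).
Proof.
apply/mapP/idP => [[i]|h]; first by rewrite mem_iota => ? ->; lia.
exists `|s - m|%N; first by rewrite mem_iota; lia.
lia.
Qed.

(** Consecutive integers covering all those within [r] of [c]; the two extra entries make up for the
    rounding of [c - r] and [2 r]. *)
Definition zball c r : seq int := zwindow (Num.floor (c - r)) (Num.truncn (2 * r)).+2.

Lemma mem_zball c r (s : int) : 0 <= r -> `|c - s%:~R| <= r -> s \in zball c r.
Proof.
move=> r0; rewrite ler_norml => /andP[h1 h2].
have [f1 f2] := andP (floor_itv (c - r)).
have t := truncnS_gt (2 * r).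
rewrite mem_zwindow -(@ler_int R) -(@ltr_int R); apply/andP; split; first by lra.
rewrite intrD; move: f2 t; rewrite intrD /= -pmulrn -[(_.+2)%:R]natr1.
set k := (_.+1)%:R; lra.
Qed.

Lemma size_zball c r : 0 <= r -> (size (zball c r))%:R <= 2 * r + 2.
Proof.
move=> r0; rewrite size_map size_iota -addn2 natrD lerD2r.
by rewrite truncn_le; lra.
Qed.

Lemma zsum_zball f c r : 0 <= r -> (forall s, r < `|c - s%:~R| -> f s = 0) ->
  zsum f = \sum_(s <- zball c r) f s.
Proof.
move=> r0 f0; apply: zsumE; first exact: uniq_zwindow.
move=> s /negP hs; apply: f0; rewrite ltNge; apply/negP => h.
exact/hs/mem_zball.
Qed.

Lemma norm_zsum_le f c r b : 0 <= r -> (forall s, r < `|c - s%:~R| -> f s = 0) ->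
  (forall s, `|f s| <= b) -> `|zsum f| <= (2 * r + 2) * b.
Proof.
move=> r0 f0 fb; rewrite (zsum_zball r0 f0).
apply: le_trans (ler_norm_sum _ _ _) _.
apply: (@le_trans _ _ (\sum_(s <- zball c r) b)); first by apply: ler_sum => s _.
rewrite big_const_seq count_predT iter_addr_0 -[leLHS]mulr_natl ler_wpM2r ?size_zball //.
exact: le_trans (normr_ge0 _) (fb 0).
Qed.

(** Each integer is [m + i - q a] for a unique [i < q] and a unique [a]. The free base point [m]
    later allows centring the residues near a given real. *)
Lemma zsum_residues f (q : nat) (m : int) c r : (0 < q)%N -> 0 <= r ->
  (forall s, r < `|c - s%:~R| -> f s = 0) ->
  zsum f = \sum_(0 <= i < q) zsum (fun a => f (m + i%:Z - q%:Z * a)).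
Proof.
move=> q0 r0 f0.
(* A symmetric window, oversized so that any [a] outside it sends [m + i - q a] out of the ball for
   every [i < q]. *)
pose A : seq int := zwindow (- (`|m| + q%:Z + `|Num.floor (c - r)| + (Num.truncn (2 * r)).+2%:Z))
  (2 * (`|m|%N + q + `|Num.floor (c - r)|%N + (Num.truncn (2 * r)).+2)).+1.
have fA s : s \notin zball c r -> f s = 0.
  move=> /negP hs; apply: f0; rewrite ltNge; apply/negP => h; exact/hs/mem_zball.
have q0' : q%:Z != 0 by lia.
rewrite (@zsumE [seq m + i%:Z - q%:Z * a | i <- iota 0 q, a <- A]).
- rewrite big_allpairs_dep /= /index_iota subn0; apply: eq_big_seq => i.
  rewrite mem_iota => hi; rewrite (@zsumE A) //; first exact: uniq_zwindow.
  move=> a; rewrite mem_zwindow => ha; apply: fA.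
  rewrite /zball mem_zwindow; apply/negP => hb; move/negP: ha; apply.
  nia.
- apply: allpairs_uniq; rewrite ?iota_uniq ?uniq_zwindow // => -[i a] [j b].
  move=> /allpairsP[[i' a'] [hi' _ [? ?]]] /allpairsP[[j' b'] [hj' _ [? ?]]] /= e.
  subst i a j b.
  move: hi' hj' e; rewrite !mem_iota /= add0n => hi' hj' e.
  have ? : a' = b' by have [lt|lt|//] := ltgtP a' b'; exfalso; nia.
  have ? : i' = j' by nia.
  by subst.
- move=> s hs; apply: fA; apply/negP => hb; move/negP: hs; apply.
  pose i := `|((s - m) %% q)%Z|%N.
  have hm : ((s - m) %% q)%Z = i%:Z by rewrite /i gez0_abs // modz_ge0.
  have hi : (i < q)%N by rewrite -ltz_nat -hm ltz_pmod.
  have e := divz_eq (s - m) q%:Z; rewrite hm in e.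
  apply/allpairsP; exists (i, - ((s - m) %/ q)%Z) => /=; split.
  + by rewrite mem_iota.
  + move: hb; rewrite /zball !mem_zwindow => hb; nia.
  + lia.
Qed.

End IntegerSums.

(** * The Fejér kernel *)

Section FejerKernel.
Variable R : realType.
Implicit Types (x v u t : R).

Lemma cosDint x (m : int) : cos (x + 2 * pi * m%:~R) = cos x.
Proof.
have h (y : R) (n : nat) : cos (y + 2 * pi * n%:R) = cos y.
  have -> : 2 * pi * n%:R = pi *+ 2 *+ n :> R.
    by rewrite -mulrnA -[RHS]mulr_natr natrM; ring.
  by rewrite (periodicn (@cosD2pi R)).
case: m => n; first exact: h.
by rewrite NegzE mulrNz -[LHS](h _ n.+1) mulrN subrK.
Qed.

(** A weak Jordan inequality. On [[0, 1]] the derivative is [cos c = 1 - 2 sin(c / 2) ^ 2 >= 1/2];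
    past 1, monotonicity gives [sin x >= sin 1 >= 1/2], while [x / 4 < 1/2] because [pi < 4]. *)
Lemma sin_ge_quarter x : 0 <= x <= pi / 2 -> x / 4 <= sin x.
Proof.
have p2 := @pihalf_ge1 R; have p4 := @pihalf_lt2 R.
have h1 (z : R) : 0 <= z <= 1 -> z / 2 <= sin z.
  move=> /andP[z0 z1].
  have dF (y : R) : is_derive y 1 (fun y : R => sin y - y / 2) (cos y - 2^-1).
    by apply: is_derive_eq; rewrite /GRing.scale /=; ring.
  have cF : {within `[(0 : R), z], continuous (fun y : R => sin y - y / 2)}.
    apply: continuous_subspaceT => y; apply: differentiable_continuous.
    by apply/derivable1_diffP; have [] := dF y.
  have [c hc e] := MVT_segment z0 (fun y _ => dF y) cF.
  rewrite sin0 mul0r !subr0 in e.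
  suff : 2^-1 <= cos c by nra.
  move: hc; rewrite in_itv /= => /andP[c0 cz].
  have s0 : 0 <= sin (c / 2) by apply: sin_ge0_pi; apply/andP; split; lra.
  have s1 : sin (c / 2) <= c / 2.
    have c20 : 0 <= c / 2 by lra.
    have dS (y : R) : is_derive y 1 (@sin R) (cos y) by exact: is_derive_sin.
    have cS : {within `[(0 : R), c / 2], continuous (@sin R)}.
      by apply: continuous_subspaceT => y; exact: continuous_sin.
    have [b _ eb] := MVT_segment c20 (fun y _ => dS y) cS.
    rewrite sin0 !subr0 in eb; rewrite eb.
    by have := cos_le1 b; nra.
  have -> : cos c = 1 - 2 * sin (c / 2) ^+ 2.
    have {1}-> : c = (c / 2) *+ 2 by rewrite -[RHS]mulr_natr; field.
    by rewrite cos_mulr2n cos2sin2 mulr2n; ring.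
  nra.
move=> /andP[x0 xp]; have [x1|x1] := leP x 1.
  by apply: le_trans (h1 x _); [lra|apply/andP].
apply: (@le_trans _ _ (sin 1)).
  by have := h1 1; rewrite ler01 lexx => /(_ isT); lra.
by apply: ltW; rewrite ltr_sin // in_itv /=; apply/andP; split; lra.
Qed.

Lemma one_sub_cosE x : 1 - cos (2 * x) = 2 * sin x ^+ 2.
Proof. by rewrite mulr_natl cos_mulr2n cos2sin2 mulr2n; ring. Qed.

(** Serves twice: to control the second moment of the Fejér kernel, and to bound from below the
    factor [2 - 2 cos th] produced by summation by parts. *)
Lemma one_sub_cos_ge v : `|v| <= 2^-1 -> v ^+ 2 / 2 <= 1 - cos (2 * pi * v).
Proof.
move=> hv; rewrite -cos_norm normrM ger0_norm; last by rewrite mulr_ge0 ?pi_ge0.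
rewrite -[2 * pi * _]mulrA one_sub_cosE -real_normK ?num_real //.
have v0 := normr_ge0 v; have p2 := @pi_ge2 R.
have : pi * `|v| / 4 <= sin (pi * `|v|).
  by apply: sin_ge_quarter; apply/andP; split; nra.
set s := sin _ => hs.
have : `|v| / 2 <= s by nra.
nra.
Qed.

Definition natdist (l l' : nat) : nat := (l - l' + (l' - l))%N.

(** With [e(x) = exp(2 i pi x)], this is the squared modulus of the sum of the [e(l v)] for [l < M],
    divided by [M]; the double sum displays the frequencies as natural numbers. *)
Definition fejer (M : nat) v : R :=
  M%:R^-1 * \sum_(0 <= l < M) \sum_(0 <= l' < M) cos (2 * pi * (natdist l l')%:R * v).

Lemma cos_natdist l l' x :
  cos (2 * pi * (natdist l l')%:R * x) = cos (2 * pi * l%:R * x - 2 * pi * l'%:R * x).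
Proof.
wlog le : l l' / (l <= l')%N => [hw|].
  have [/hw//|/ltnW/hw h] := leqP l l'.
  by rewrite -[RHS]cosN opprB -h /natdist addnC.
rewrite -[RHS]cosN opprB /natdist (_ : (l - l' = 0)%N) ?add0n ?natrB //; last by lia.
by congr cos; ring.
Qed.

Lemma fejerE M v : fejer M v = M%:R^-1 *
  ((\sum_(0 <= l < M) cos (2 * pi * l%:R * v)) ^+ 2 +
   (\sum_(0 <= l < M) sin (2 * pi * l%:R * v)) ^+ 2).
Proof.
congr (_ * _); rewrite !expr2 !mulr_suml -big_split /=; apply: eq_bigr => l _.
rewrite !mulr_sumr -big_split /=; apply: eq_bigr => l' _.
by rewrite cos_natdist cosB.
Qed.

Lemma fejer_ge0 M v : 0 <= fejer M v.
Proof. by rewrite fejerE mulr_ge0 ?invr_ge0 // addr_ge0 ?sqr_ge0. Qed.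

(** Multiplying the geometric sum by [1 - e(v)] leaves [1 - e(M v)], whose real and imaginary parts
    are proved in [h]. By squared moduli, the left side equals [(1 - cos (2 pi M v)) / M]. *)
Lemma fejer_concentrated M v : fejer M v * (1 - cos (2 * pi * v)) <= 2 / M%:R.
Proof.
have h (n : nat) :
    let C := \sum_(0 <= l < n) cos (2 * pi * l%:R * v) in
    let S := \sum_(0 <= l < n) sin (2 * pi * l%:R * v) in
    let t := 2 * pi * v in
    C * (1 - cos t) + S * sin t = 1 - cos (2 * pi * n%:R * v) /\
    S * (1 - cos t) - C * sin t = - sin (2 * pi * n%:R * v).
  elim: n => [|n /= [IH1 IH2]] /=.
    by rewrite !big_nil mulr0 mul0r cos0 sin0; split; ring.
  rewrite !big_nat_recr //=.
  have -> : 2 * pi * n.+1%:R * v = 2 * pi * n%:R * v + 2 * pi * v.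
    by rewrite -natr1; ring.
  by rewrite cosD sinD; split; lra.
have [h1 h2] := h M; rewrite fejerE.
set C := \sum_(_ <= _ < _) _ in h1 h2 *; set S := \sum_(_ <= _ < _) _ in h1 h2 *.
set t := 2 * pi * v in h1 h2 *; set T := 2 * pi * M%:R * v in h1 h2.
have e1 := sin2cos2 t; have e2 := sin2cos2 T.
have e : 2 * ((C ^+ 2 + S ^+ 2) * (1 - cos t)) = 2 - 2 * cos T.
  have e3 : (1 - cos T) ^+ 2 + (- sin T) ^+ 2 = 2 - 2 * cos T by ring: e2.
  have e4 : (C * (1 - cos t) + S * sin t) ^+ 2 + (S * (1 - cos t) - C * sin t) ^+ 2
     = 2 * ((C ^+ 2 + S ^+ 2) * (1 - cos t)) by ring: e1.
  by rewrite -e4 h1 h2 e3.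
have := cos_geN1 T => gT.
rewrite -mulrA mulrC ler_wpM2r ?invr_ge0 //; lra.
Qed.

Lemma fejerDint M v (m : int) : fejer M (v + m%:~R) = fejer M v.
Proof.
congr (_ * _); apply: eq_bigr => l _; apply: eq_bigr => l' _.
rewrite mulrDr -[RHS](cosDint _ ((natdist l l')%:Z * m)) intrM.
by rewrite -pmulrn !mulrA.
Qed.

(** Multiplication by [2 sin (th / 2)] makes the sum telescope over [m] full periods, and
    [0 < m < q] keeps [sin (th / 2)] nonzero. *)
Lemma sum_cos_residues (q m : nat) x : (0 < m < q)%N ->
  \sum_(0 <= i < q) cos (x + 2 * pi * m%:R / q%:R * i%:R) = 0.
Proof.
move=> /andP[m0 mq]; have q0 : 0 < q%:R :> R by rewrite ltr0n; lia.
set th := 2 * pi * m%:R / q%:R.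
have s0 : 0 < sin (th / 2).
  apply: sin_gt0_pi; rewrite /th.
  have -> : 2 * pi * m%:R / q%:R / 2 = pi * (m%:R / q%:R) :> R by field; rewrite gt_eqF.
  have mq0 : 0 < m%:R / q%:R :> R by rewrite divr_gt0 // ltr0n.
  have mq1 : m%:R / q%:R < 1 :> R by rewrite ltr_pdivrMr // mul1r ltr_nat.
  by have := @pi_gt0 R => p0; apply/andP; split; nra.
have tel (n : nat) : 2 * sin (th / 2) * \sum_(0 <= i < n) cos (x + th * i%:R) =
    sin (x + th * n%:R - th / 2) - sin (x - th / 2).
  elim: n => [|n IH]; first by rewrite big_nil mulr0 mulr0 addr0 subrr.
  rewrite big_nat_recr //= mulrDr IH.
  have -> : x + th * n.+1%:R - th / 2 = (x + th * n%:R) + th / 2.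
    by rewrite -natr1; field.
  by rewrite (sinB (x + th * _)) (sinD (x + th * _)); ring.
have : 2 * sin (th / 2) * \sum_(0 <= i < q) cos (x + th * i%:R) = 0.
  rewrite tel.
  have -> : x + th * q%:R - th / 2 = (x - th / 2) + pi *+ 2 *+ m.
    by rewrite -mulrnA -[pi *+ _]mulr_natr natrM /th; field; rewrite gt_eqF.
  by rewrite (periodicn (@sinD2pi R)) subrr.
by move/eqP; rewrite mulf_eq0 mulf_eq0 pnatr_eq0 /= (gt_eqF s0) /= => /eqP.
Qed.

(** The sample points run over a full period, so frequencies strictly between 0 and [q] cancel. As
    [M <= q], all off-diagonal pairs are of this kind, and only the diagonal survives. *)
Lemma fejer_mean (M q : nat) u (m : int) : (0 < M <= q)%N ->
  \sum_(0 <= i < q) fejer M (u - (m + i%:Z)%:~R / q%:R) = q%:R.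
Proof.
move=> /andP[M0 Mq]; have q0 : q%:R != 0 :> R by rewrite pnatr_eq0; lia.
rewrite -mulr_sumr exchange_big_nat /=.
under eq_bigr => l _ do rewrite exchange_big_nat /=.
have -> : \sum_(0 <= l < M) \sum_(0 <= l' < M) \sum_(0 <= i < q)
     cos (2 * pi * (natdist l l')%:R * (u - (m + i%:Z)%:~R / q%:R)) =
   \sum_(0 <= l < M) q%:R.
  apply: eq_big_nat => l lM.
  rewrite (bigD1_seq l) ?iota_uniq ?mem_index_iota //= [X in _ + X]big1_seq.
    rewrite addr0 /natdist subnn addn0.
    under eq_bigr do rewrite mulr0 mul0r cos0.
    by rewrite sumr_const_nat subn0.
  move=> l' /andP[nl]; rewrite mem_index_iota => l'M.
  have hd : (0 < natdist l l' < q)%N by rewrite /natdist; lia.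
  set k := natdist l l' in hd *.
  rewrite -[RHS](sum_cos_residues (2 * pi * k%:R * (m%:~R / q%:R - u)) hd).
  apply: eq_bigr => i _; rewrite -cosN; congr cos.
  by rewrite intrD -pmulrn; field.
by rewrite sumr_const_nat subn0 -[q%:R *+ M]mulr_natr mulrCA mulVf ?mulr1 // pnatr_eq0; lia.
Qed.

(** Each distance [m >= 1] from [l] is reached at most once on either side. *)
Lemma sum_natdist_le (M l : nat) (h : nat -> R) : (l < M)%N -> (forall m, 0 <= h m) ->
  \sum_(0 <= l' < M | l' != l) h (natdist l l') <= 2 * \sum_(1 <= m < M) h m.
Proof.
move=> lM h0.
rewrite (@big_cat_nat _ _ _ l.+1) //= mulr2n mulrDl mul1r; apply: lerD.
- rewrite big_mkcond big_nat_recr //= eqxx addr0 big_nat_rev /= add0n.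
  apply: (@le_trans _ _ (\sum_(1 <= m < l.+1) h m)).
    rewrite big_add1 /= le_eqVlt; apply/orP; left; apply/eqP/eq_big_nat => i il.
    rewrite ifT; last by lia.
    by congr h; rewrite /natdist; lia.
  by rewrite [leRHS](@big_cat_nat _ _ _ l.+1) //= lerDl sumr_ge0.
- apply: (@le_trans _ _ (\sum_(1 <= m < M - l) h m)).
    rewrite -{1}(add1n l) big_addn big_mkcond; apply: ler_sum_nat => i il.
    rewrite ifT; last by lia.
    by rewrite (_ : natdist _ _ = i) // /natdist; lia.
  by rewrite [leRHS](@big_cat_nat _ _ _ (M - l)) //= ?lerDl ?sumr_ge0 //; lia.
Qed.

End FejerKernel.

(** * Linearity of integer sums *)

Section IntegerSumsLinear.
Variable R : realType.
Implicit Types (f g : int -> R) (c r : R).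

Lemma zsumZ f (b : R) : zsum (fun s => b * f s) = b * zsum f.
Proof. by rewrite /zsum mulr_fsumr. Qed.

Lemma zsumD f g c r : 0 <= r -> (forall s, r < `|c - s%:~R| -> f s = 0) ->
  (forall s, r < `|c - s%:~R| -> g s = 0) ->
  zsum (fun s => f s + g s) = zsum f + zsum g.
Proof.
move=> r0 f0 g0; rewrite (zsum_zball r0 f0) (zsum_zball r0 g0).
rewrite (@zsum_zball _ _ c r) // ?big_split // => s h.
by rewrite f0 // g0 // addr0.
Qed.

End IntegerSumsLinear.

(** * Approximation of the periodized bump *)

Section Periodization.
Variables (R : realType) (w : R -> R) (B : R).
Hypothesis w_range : forall x, 0 <= w x <= 1.
Hypothesis w_supp : forall x, 2 < `|x| -> w x = 0.
Hypothesis B0 : 0 <= B.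
Hypothesis w_lip : forall x y, `|w x - w y| <= B * `|x - y|.
Hypothesis w_diff2 : forall x h, 0 <= h ->
  `|w (x + h) + w (x - h) - 2 * w x| <= B * h ^+ 2.
Variable delta : R.
Hypothesis delta0 : 0 < delta.
Implicit Types (u v x y e : R) (M q : nat).

Definition periodization u : R := zsum (fun a => w ((u - a%:~R) / delta)).

Let norm_w x : `|w x| <= 1.
Proof. by have /andP[? ?] := w_range x; rewrite ger0_norm. Qed.

Let w_eq0 u : 2 * delta < `|u| -> w (u / delta) = 0.
Proof.
by move=> h; apply: w_supp; rewrite normrM normfV (gtr0_norm delta0) ltr_pdivlMr.
Qed.

(** For two points at distance at most 1/2, at most [2 (2 delta + 1/2) + 2] translates are nonzero
    at one of them, and each translate has Lipschitz constant [B / delta]. *)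
Definition lip_const : R := (2 * (2 * delta + 2^-1) + 2) * (B / delta).

Lemma lip_const_ge0 : 0 <= lip_const.
Proof.
have d0 := delta0; have b0 := B0.
by apply: mulr_ge0; [lra|rewrite divr_ge0 // ltW].
Qed.

Lemma periodization_lip u v : `|u - v| <= 2^-1 ->
  `|periodization u - periodization v| <= lip_const * `|u - v|.
Proof.
have d0 := delta0.
move=> uv; pose r := 2 * delta + 2^-1; have r0 : 0 <= r by rewrite /r; lra.
have du a : r < `|u - a| -> w ((u - a) / delta) = 0.
  by move=> h; apply: w_eq0; move: h; rewrite /r; lra.
have dv a : r < `|u - a| -> w ((v - a) / delta) = 0.
  move=> h; apply: w_eq0; move: h; rewrite /r => h.
  have : `|u - a| <= `|u - v| + `|v - a|.
    by rewrite (_ : u - a = u - v + (v - a)) ?ler_normD //; ring.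
  lra.
rewrite (_ : periodization u - periodization v =
    zsum (fun a => w ((u - a%:~R) / delta) + (-1) * w ((v - a%:~R) / delta))); last first.
  rewrite (@zsumD _ _ _ u r) ?zsumZ ?mulN1r //.
  - by move=> s; exact: du.
  - by move=> s h; rewrite dv ?mulr0.
have key := @norm_zsum_le R
  (fun a => w ((u - a%:~R) / delta) + (-1) * w ((v - a%:~R) / delta))
  u r (B / delta * `|u - v|) r0.
rewrite /lip_const -[_ * (B / delta) * _]mulrA; apply: key.
- by move=> s h; rewrite du // dv // mulr0 addr0.
- move=> s; rewrite mulN1r; apply: le_trans (w_lip _ _) _.
  rewrite -mulrA ler_wpM2l // -mulrBl normrM normfV (gtr0_norm delta0) mulrC.
  by rewrite (_ : u - _ - _ = u - v) //; ring.
Qed.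

Lemma continuous_periodization : continuous periodization.
Proof.
move=> u; apply/cvgrPdist_le => /= e e0.
have L0 := lip_const_ge0.
have k0 : 0 < Num.min (2^-1) (e / (lip_const + 1)).
  by rewrite lt_min invr_gt0 ltr0n /= divr_gt0 //; lra.
near=> v.
have : `|u - v| <= Num.min (2^-1) (e / (lip_const + 1)).
  near: v; apply: cvgr_dist_le k0; exact: cvg_id.
rewrite le_min => /andP[h1 h2]; apply: le_trans (periodization_lip h1) _.
apply: (@le_trans _ _ (lip_const * (e / (lip_const + 1)))); first by rewrite ler_wpM2l.
rewrite mulrA ler_pdivrMr; last by lra.
by have := ltW e0; nra.
Unshelve. all: by end_near. Qed.

Definition fejer_approx M q u : R :=
  q%:R^-1 * zsum (fun s => w (s%:~R / (q%:R * delta)) * fejer M (u - s%:~R / q%:R)).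

Let w_q_eq0 q (s : int) : (0 < q)%N -> 2 * (q%:R * delta) < `|0 - s%:~R| ->
  w (s%:~R / (q%:R * delta)) = 0.
Proof.
move=> q0 h; have qd : 0 < q%:R * delta by rewrite mulr_gt0 ?ltr0n.
apply: w_supp; rewrite normrM normfV (gtr0_norm qd) ltr_pdivlMr //.
by rewrite sub0r normrN in h.
Qed.

(** As [fejer] is 1-periodic, samples in one class modulo [q] share a kernel value, and the bumps
    collect into the periodization. The unfolded form exposes Fourier coefficients, this one an
    average against the kernel. *)
Lemma fejer_approxE M q u (m : int) : (0 < q)%N ->
  fejer_approx M q u = q%:R^-1 * \sum_(0 <= i < q)
    (periodization ((m + i%:Z)%:~R / q%:R) * fejer M (u - (m + i%:Z)%:~R / q%:R)).
Proof.
move=> q0; have q0' : q%:R != 0 :> R by rewrite pnatr_eq0 -lt0n.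
congr (_ * _); rewrite (@zsum_residues R _ q m 0 (2 * (q%:R * delta))) //.
- apply: eq_bigr => i _; rewrite [RHS]mulrC /periodization -zsumZ.
  congr zsum; apply/funext => a; rewrite [LHS]mulrC; congr (_ * w _).
    rewrite -[RHS](fejerDint _ _ a); congr fejer.
    by rewrite [in LHS]intrB intrM -[q%:~R]pmulrn; field.
  by rewrite intrB intrM -[q%:~R]pmulrn; field; rewrite q0' gt_eqF.
- by rewrite !mulr_ge0 // ltW.
- by move=> s h; rewrite w_q_eq0 // mul0r.
Qed.

(** By [fejer_mean] the difference is an average, against a nonnegative kernel, of increments of
    size at most [lip_const * |v|]. Then [|v| <= eta + v ^ 2 / eta], and [fejer_concentrated]
    controls the second moment. *)
Lemma fejer_approx_dist M q u (eta : R) : (0 < M <= q)%N -> 0 < eta ->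
  `|fejer_approx M q u - periodization u| <= lip_const * (eta + 4 / (M%:R * eta)).
Proof.
have d0 := delta0.
move=> Mq eta0; have /andP[M0 Mq'] := Mq; have q0 : (0 < q)%N by exact: leq_trans Mq'.
have qR : 0 < q%:R :> R by rewrite ltr0n.
have MR : 0 < M%:R :> R by rewrite ltr0n.
(* With this base point the sample points [r i] all lie within 1/2 of [u]. *)
pose m := Num.floor (q%:R * (u - 2^-1)) + 1.
pose r (i : nat) : R := (m + i%:Z)%:~R / q%:R.
have L0 := lip_const_ge0.
have -> : fejer_approx M q u - periodization u = q%:R^-1 * \sum_(0 <= i < q)
   ((periodization (r i) - periodization u) * fejer M (u - r i)).
  under eq_bigr do rewrite mulrBl.
  rewrite sumrB -mulr_sumr (fejer_mean u m Mq) mulrBr -(fejer_approxE M u m q0).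
  by congr (_ - _); rewrite mulrCA mulVf ?mulr1 // gt_eqF.
rewrite normrM normfV (gtr0_norm qR) ler_pdivrMl //.
apply: le_trans (ler_norm_sum _ _ _) _.
apply: (@le_trans _ _ (\sum_(0 <= i < q)
    (lip_const * eta * fejer M (u - r i) + lip_const * (4 / (M%:R * eta))))); last first.
  rewrite big_split /= -mulr_sumr (fejer_mean u m Mq) sumr_const_nat subn0.
  by rewrite -[_ *+ q]mulr_natr mulrDr mulrDr; lra.
apply: ler_sum_nat => i /andP[_ iq].
set v := u - r i.
have hv : `|v| <= 2^-1.
  have /andP[f1 f2] := floor_itv (q%:R * (u - 2^-1)).
  have e : q%:R * r i = (Num.floor (q%:R * (u - 2^-1)))%:~R + 1 + i%:R.
    by rewrite /r mulrCA mulfV ?gt_eqF // mulr1 /m !intrD -pmulrn.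
  rewrite intrD in f2.
  have hi : i%:R + 1 <= q%:R :> R by rewrite natr1 ler_nat.
  have hi0 : 0 <= i%:R :> R by [].
  rewrite ler_norml; apply/andP; split; rewrite -(ler_pM2l qR) /v mulrBr e; lra.
have F0 := fejer_ge0 M v.
rewrite normrM (ger0_norm F0).
have h1 : `|periodization (r i) - periodization u| <= lip_const * `|v|.
  by rewrite distrC periodization_lip.
apply: le_trans (ler_wpM2r F0 h1) _.
rewrite -mulrA -mulrA -mulrDr ler_wpM2l //.
have h2 := one_sub_cos_ge hv; have h3 := fejer_concentrated M v.
have h4 : `|v| <= eta + v ^+ 2 / eta.
  rewrite -real_normK ?num_real // -subr_ge0.
  have -> : eta + `|v| ^+ 2 / eta - `|v| = ((eta - `|v|) ^+ 2 + eta * `|v|) / eta.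
    by field; rewrite gt_eqF.
  by rewrite divr_ge0 ?(ltW eta0) // addr_ge0 ?sqr_ge0 // mulr_ge0 // ltW.
apply: le_trans (ler_wpM2r F0 h4) _; rewrite mulrDl lerD2l.
have -> : 4 / (M%:R * eta) = (2 * (2 / M%:R)) / eta by field; rewrite !gt_eqF.
rewrite mulrAC ler_pM2r ?invr_gt0 //.
by move: h2 h3; set C := cos _; set F := fejer _ _ in F0 *; nra.
Qed.

(** [M] is fixed before [q], which can then be as large as the coefficient bounds require. [eta]
    brings the first error term below [e / 2], then [M] the second. *)
Lemma fejer_approx_unif e : 0 < e -> exists2 M, (0 < M)%N & forall q u, (M <= q)%N ->
  `|fejer_approx M q u - periodization u| <= e.
Proof.
have d0 := delta0.
move=> e0; have L0 := lip_const_ge0.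
pose eta := e / (2 * (lip_const + 1)).
have eta0 : 0 < eta by rewrite divr_gt0 //; lra.
pose M := (Num.truncn (8 * lip_const / (eta * e))).+1.
exists M => // q u Mq; apply: le_trans (fejer_approx_dist _ _ eta0) _; first by rewrite Mq.
have hM := truncnS_gt (8 * lip_const / (eta * e)); rewrite -/M in hM.
have MR : 0 < M%:R :> R by rewrite ltr0n.
rewrite ltr_pdivrMr in hM; last by rewrite mulr_gt0.
rewrite mulrDr; have -> : e = e / 2 + e / 2 by field.
apply: lerD.
  rewrite /eta mulrA ler_pdivrMr; last by lra.
  nra.
rewrite mulrA ler_pdivrMr; last by rewrite mulr_gt0.
lra.
Qed.

(** Counting the [O(q delta)] nonzero samples gives the trivial bound. Otherwise, summing by parts
    twice replaces [W] by its second difference, of size [B / (q delta) ^ 2], at the price of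
    dividing by [2 - 2 cos th], which is at least [(m / q) ^ 2] because [2 m <= q]. The phase [phi]
    makes the bound cover cosines and sines alike. *)
Lemma norm_cos_coeff_le q (m : nat) (phi : R) : (0 < m)%N -> (2 * m <= q)%N ->
  1 <= q%:R * delta ->
  `|q%:R^-1 * zsum (fun s => w (s%:~R / (q%:R * delta)) *
       cos (2 * pi * m%:R / q%:R * s%:~R + phi))|
  <= 8 * (B + 1) * (delta * Num.min 1 ((delta * m%:R) ^- 2)).
Proof.
have d0 := delta0; have b0 := B0.
move=> m0 mq qd1; have q0 : (0 < q)%N by lia.
have qR : 0 < q%:R :> R by rewrite ltr0n.
have mR : 0 < m%:R :> R by rewrite ltr0n.
have qd : 0 < q%:R * delta by rewrite mulr_gt0.
have r0 : 0 <= 2 * (q%:R * delta) by rewrite mulr_ge0 // ltW.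
set th := 2 * pi * m%:R / q%:R.
set X := zsum _.
rewrite normrM normfV (gtr0_norm qR) ler_pdivrMl // mulrCA.
have gR : 0 <= 8 * (B + 1) by lra.
have [h|h] := leP 1 ((delta * m%:R) ^- 2).
  rewrite mulr1.
  have h0 := @norm_zsum_le R (fun s => w (s%:~R / (q%:R * delta)) * cos (th * s%:~R + phi)) 0 (2 * (q%:R * delta)) 1 r0.
  apply: le_trans (h0 _ _) _.
  - by move=> s hs; rewrite w_q_eq0 // mul0r.
  - by move=> s; rewrite normrM -[leRHS]mulr1; apply: ler_pM => //; exact: cos_max.
  - nra.
pose W (s : int) := w (s%:~R / (q%:R * delta)).
(* The radius is enlarged by 1 to contain the supports of both unit shifts of [W]. *)
have r1 : 0 <= 2 * (q%:R * delta) + 1 by lra.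
have Ws0 (s k : int) : `|k%:~R| <= 1 :> R -> 2 * (q%:R * delta) + 1 < `|0 - s%:~R| -> W (s + k) = 0.
  move=> k1 hs; apply: w_q_eq0 => //.
  have : `|0 - s%:~R| <= `|0 - (s + k)%:~R| + `|k%:~R| :> R.
    by rewrite (_ : 0 - s%:~R = 0 - (s + k)%:~R + k%:~R) ?ler_normD // intrD; ring.
  lra.
pose h1 := (q%:R * delta)^-1.
have h10 : 0 <= h1 by rewrite invr_ge0 ltW.
pose D (s : int) := W (s + 1) + W (s + -1) - 2 * W s.
have hD s : `|D s| <= B * h1 ^+ 2.
  have := w_diff2 (s%:~R / (q%:R * delta)) h10.
  by rewrite /D /W !intrD /= !mulrDl mul1r mulNr mul1r.
have W0 s : 2 * (q%:R * delta) + 1 < `|0 - s%:~R| -> W s = 0.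
  by move=> hs; rewrite -[s]addr0 Ws0 // normr0.
have hs1 s : 2 * (q%:R * delta) + 1 < `|0 - s%:~R| -> W (s + 1) = 0.
  by apply: Ws0; rewrite normr1.
have hs2 s : 2 * (q%:R * delta) + 1 < `|0 - s%:~R| -> W (s + -1) = 0.
  by apply: Ws0; rewrite normrN normr1.
(* Shifting the index moves the differences onto the cosine, where [cos (x - th) + cos (x + th) = 2
   cos th cos x]. *)
have E : (2 - 2 * cos th) * X = - zsum (fun s => D s * cos (th * s%:~R + phi)).
  have -> : (fun s => D s * cos (th * s%:~R + phi)) = (fun s =>
      (W (s + 1) * cos (th * s%:~R + phi) + W (s + -1) * cos (th * s%:~R + phi)) +
      (-2) * (W s * cos (th * s%:~R + phi))).
    by apply/funext => s; rewrite /D; ring.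
  have z1 : zsum (fun s => W (s + 1) * cos (th * s%:~R + phi)) =
      zsum (fun s => W s * cos (th * s%:~R + phi - th)).
    rewrite -[RHS](zsum_shift _ 1); congr zsum; apply/funext => s; congr (_ * cos _).
    by rewrite intrD; ring.
  have z2 : zsum (fun s => W (s + -1) * cos (th * s%:~R + phi)) =
      zsum (fun s => W s * cos (th * s%:~R + phi + th)).
    rewrite -[RHS](zsum_shift _ (-1)); congr zsum; apply/funext => s; congr (_ * cos _).
    by rewrite intrD; ring.
  rewrite (@zsumD _ _ _ 0 (2 * (q%:R * delta) + 1)) //; first last.
  - by move=> s hs; rewrite W0 // mul0r mulr0.
  - by move=> s hs; rewrite hs1 // hs2 // !mul0r addr0.
  rewrite (@zsumD _ _ _ 0 (2 * (q%:R * delta) + 1)) //; first last.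
  - by move=> s hs; rewrite hs2 // mul0r.
  - by move=> s hs; rewrite hs1 // mul0r.
  rewrite z1 z2 zsumZ -/X -(@zsumD _ _ _ 0 (2 * (q%:R * delta) + 1)) //; first last.
  - by move=> s hs; rewrite W0 // mul0r.
  - by move=> s hs; rewrite W0 // mul0r.
  have -> : (fun s => W s * cos (th * s%:~R + phi - th) + W s * cos (th * s%:~R + phi + th)) =
      (fun s => (2 * cos th) * (W s * cos (th * s%:~R + phi))).
    by apply/funext => s; rewrite (cosB (_ + phi)) (cosD (_ + phi)); ring.
  by rewrite zsumZ -/X; ring.
have hc : m%:R ^+ 2 / q%:R ^+ 2 <= 2 - 2 * cos th.
  have hv : `|m%:R / q%:R| <= 2^-1 :> R.
    rewrite ger0_norm ?divr_ge0 // ler_pdivrMr //.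
    have : 2 * m%:R <= q%:R :> R by rewrite -natrM ler_nat.
    lra.
  by have := one_sub_cos_ge hv; rewrite /th -[2 * pi * m%:R / q%:R]mulrA expr_div_n; lra.
have hZ : `|zsum (fun s => D s * cos (th * s%:~R + phi))| <=
    (2 * (2 * (q%:R * delta) + 1) + 2) * (B * h1 ^+ 2).
  apply: (norm_zsum_le (c := 0)) => // [s hs|s].
    by rewrite /D hs1 // hs2 // W0 // mulr0 subr0 addr0 mul0r.
  rewrite normrM -[leRHS]mulr1; apply: ler_pM => //; exact: cos_max.
rewrite -normrN -E normrM in hZ.
have mq0 : 0 < m%:R ^+ 2 / q%:R ^+ 2 :> R by rewrite divr_gt0 ?exprn_gt0.
rewrite -(ler_pM2l mq0).
apply: (@le_trans _ _ (`|2 - 2 * cos th| * `|X|)).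
  by rewrite ler_wpM2r //; apply: le_trans hc _; exact: ler_norm.
apply: le_trans hZ _.
have -> : m%:R ^+ 2 / q%:R ^+ 2 * (8 * (B + 1) * (q%:R * (delta * (delta * m%:R) ^- 2))) =
   8 * (B + 1) * (q%:R * delta) * h1 ^+ 2.
  by rewrite /h1; field; rewrite !gt_eqF.
rewrite mulrA ler_wpM2r ?exprn_ge0 //.
nra.
Qed.

Lemma norm_mean_coeff_le q : (0 < q)%N -> 1 <= q%:R * delta ->
  `|q%:R^-1 * zsum (fun s => w (s%:~R / (q%:R * delta)))| <= 6 * delta.
Proof.
have d0 := delta0.
move=> q0 qd1; have qR : 0 < q%:R :> R by rewrite ltr0n.
rewrite normrM normfV (gtr0_norm qR) ler_pdivrMl //.
have r0 : 0 <= 2 * (q%:R * delta) by lra.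
apply: le_trans (norm_zsum_le (c := 0) (b := 1) r0 _ _) _ => //.
  by move=> s hs; exact: w_q_eq0.
lra.
Qed.

End Periodization.

(** * Integrals of lattice sums *)

Section OneDimensional.
Variables (R : realType) (w : R -> R) (B : R).
Hypothesis w_range : forall x, 0 <= w x <= 1.
Hypothesis w_supp : forall x, 2 < `|x| -> w x = 0.
Hypothesis B0 : 0 <= B.
Hypothesis w_lip : forall x y, `|w x - w y| <= B * `|x - y|.
Hypothesis w_diff2 : forall x h, 0 <= h ->
  `|w (x + h) + w (x - h) - 2 * w x| <= B * h ^+ 2.
Implicit Types (nu : {measure set (measurableTypeR R) -> \bar R}) (y d e t delta : R).

Definition fourier_harmonic delta (q m n : nat) y t : R := q%:R^-1 *
  zsum (fun s => w (s%:~R / (q%:R * delta)) * cos (2 * pi * m%:R * (n%:R * t - y - s%:~R / q%:R))).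

Let w_q_eq0 delta q (s : int) : 0 < q%:R * delta -> 2 * (q%:R * delta) < `|0 - s%:~R| ->
  w (s%:~R / (q%:R * delta)) = 0.
Proof.
move=> qd h; apply: w_supp; rewrite normrM normfV (gtr0_norm qd) ltr_pdivlMr //.
by rewrite sub0r normrN in h.
Qed.

Lemma fejer_approx_harmonic delta M q n y t : (0 < q)%N -> 0 < delta ->
  fejer_approx w delta M q (n%:R * t - y) =
  M%:R^-1 * \sum_(0 <= l < M) \sum_(0 <= l' < M) fourier_harmonic delta q (natdist l l') n y t.
Proof.
move=> q0 d0; have qd : 0 < q%:R * delta by rewrite mulr_gt0 ?ltr0n.
have r0 : 0 <= 2 * (q%:R * delta) by rewrite mulr_ge0 // ltW.
rewrite /fejer_approx (@zsum_zball _ _ 0 (2 * (q%:R * delta))) //; last first.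
  by move=> s hs; rewrite w_q_eq0 // mul0r.
transitivity (M%:R^-1 * \sum_(0 <= l < M) \sum_(0 <= l' < M) \sum_(s <- zball 0 (2 * (q%:R * delta)))
    (q%:R^-1 * (w (s%:~R / (q%:R * delta)) *
     cos (2 * pi * (natdist l l')%:R * (n%:R * t - y - s%:~R / q%:R))))); last first.
  congr (_ * _); apply: eq_bigr => l _; apply: eq_bigr => l' _.
  rewrite -mulr_sumr -(@zsum_zball _ (fun s : int => w (s%:~R / (q%:R * delta)) *
     cos (2 * pi * (natdist l l')%:R * (n%:R * t - y - s%:~R / q%:R))) 0) //.
  by move=> s hs; rewrite w_q_eq0 // mul0r.
under eq_bigr => s _ do rewrite /fejer mulrCA.
rewrite -mulr_sumr mulrCA; congr (_ * _).
under [RHS]eq_bigr => l _ do rewrite exchange_big /=.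
rewrite exchange_big mulr_sumr /=; apply: eq_bigr => s _.
by rewrite !mulr_sumr; apply: eq_bigr => l _; rewrite !mulr_sumr.
Qed.

Definition bump_cos_coeff delta (q m : nat) (phi : R) : R := q%:R^-1 *
  zsum (fun s => w (s%:~R / (q%:R * delta)) * cos (2 * pi * m%:R / q%:R * s%:~R + phi)).

(** The subtraction formula leaves only the frequency [n m] in [t]. The sine of the other angle is a
    cosine with phase shifted by [pi / 2], so one bound serves both coefficients. *)
Lemma fourier_harmonicE delta q m n y : (0 < q)%N -> 0 < delta ->
  fourier_harmonic delta q m n y = fun t =>
  bump_cos_coeff delta q m (2 * pi * m%:R * y) * cos (2 * pi * (n * m)%:R * t) +
  bump_cos_coeff delta q m (2 * pi * m%:R * y - pi / 2) * sin (2 * pi * (n * m)%:R * t).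
Proof.
move=> q0 d0; have qd : 0 < q%:R * delta by rewrite mulr_gt0 ?ltr0n.
have r0 : 0 <= 2 * (q%:R * delta) by rewrite mulr_ge0 // ltW.
have q0' : q%:R != 0 :> R by rewrite pnatr_eq0 -lt0n.
apply/funext => t; rewrite /bump_cos_coeff -!mulrA -!mulrDr; congr (_ * _).
rewrite [X in _ = X + _]mulrC [X in _ = _ + X]mulrC -!zsumZ.
rewrite -(@zsumD _ _ _ 0 (2 * (q%:R * delta))) //; first last.
- by move=> s hs; rewrite w_q_eq0 // mul0r mulr0.
- by move=> s hs; rewrite w_q_eq0 // mul0r mulr0.
congr zsum; apply/funext => s.
rewrite addrA cosBpihalf mulrCA [X in _ = _ + X]mulrCA -mulrDr -cosB; congr (_ * cos _).
by rewrite natrM; field.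
Qed.

Lemma continuous_harmonic delta q m n y : (0 < q)%N -> 0 < delta ->
  continuous (fourier_harmonic delta q m n y).
Proof.
move=> q0 d0.
rewrite fourier_harmonicE //.
move=> t; apply: cvgD; apply: cvgM; try exact: cvg_cst.
- have := @continuous_cosZ R (2 * pi * (n * m)%:R) 0 t.
  by under eq_fun do rewrite addr0.
- exact: continuous_sinZ.
Qed.

Lemma norm_Rintegral_harmonic_le nu delta q m n y : nu `[0%R, 1%R]%classic = 1%E ->
  0 < delta -> (0 < m)%N -> (2 * m <= q)%N -> 1 <= q%:R * delta ->
  `|Rintegral nu `[0%R, 1%R] (fourier_harmonic delta q m n y)| <=
  16 * (B + 1) * delta * (Num.min 1 ((delta * m%:R) ^- 2) * abs_fourier nu (n * m)%:R).
Proof.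
move=> nu1 d0 m0 mq qd1; have q0 : (0 < q)%N by lia.
rewrite fourier_harmonicE //.
have cc : continuous (fun t : R => cos (2 * pi * (n * m)%:R * t)).
  move=> t; have := @continuous_cosZ R (2 * pi * (n * m)%:R) 0 t.
  by under eq_fun do rewrite addr0.
have cs : continuous (fun t : R => sin (2 * pi * (n * m)%:R * t)) by exact: continuous_sinZ.
have cZ (c : R) (f : R -> R) : continuous f -> continuous (fun t => c * f t).
  by move=> cf t; apply: cvgM; [exact: cvg_cst|exact: cf].
rewrite RintegralD //; [|exact: continuous_itv01_integrable nu1 _ (cZ _ _ _)..].
rewrite !RintegralZl //; [|exact: continuous_itv01_integrable nu1 _ _..].
have g0 : 0 <= Num.min 1 ((delta * m%:R) ^- 2).
  by rewrite le_min ler01 invr_ge0 exprn_ge0 // mulr_ge0 // ltW.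
apply: le_trans (ler_normD _ _) _.
rewrite !(normrM (bump_cos_coeff _ _ _ _)).
have h phi : `|bump_cos_coeff delta q m phi| <= _ :=
  norm_cos_coeff_le w_range w_supp B0 w_diff2 d0 phi m0 mq qd1.
have := norm_Rintegral_cos_le nu (n * m)%:R.
have := norm_Rintegral_sin_le nu (n * m)%:R.
set a := abs_fourier _ _; set x := Rintegral _ _ _; set z := Rintegral _ _ _ => hx hz.
have e1 := ler_pM (normr_ge0 _) (normr_ge0 _) (h (2 * pi * m%:R * y)) hz.
have e2 := ler_pM (normr_ge0 _) (normr_ge0 _) (h (2 * pi * m%:R * y - pi / 2)) hx.
apply: le_trans (lerD e1 e2) _.
set g := Num.min _ _; lra.
Qed.

(** The diagonal pairs reproduce the zeroth coefficient. In each row the other pairs meet every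
    distance at most twice, whence 32 = 2 * 16, and the number of rows cancels [M^-1]. *)
Lemma Rintegral_fejer_approx_dist nu delta (M q n : nat) y :
  nu `[0%R, 1%R]%classic = 1%E -> (0 < M)%N ->
  0 < delta -> (2 * M <= q)%N -> 1 <= q%:R * delta ->
  `|Rintegral nu `[0%R, 1%R] (fun t => fejer_approx w delta M q (n%:R * t - y)) -
    q%:R^-1 * zsum (fun s => w (s%:~R / (q%:R * delta)))| <=
  32 * (B + 1) * delta *
    \sum_(1 <= m < M) (Num.min 1 ((delta * m%:R) ^- 2) * abs_fourier nu (n * m)%:R).
Proof.
move=> nu1 M0 d0 Mq qd1; have q0 : (0 < q)%N by lia.
have MR : 0 < M%:R :> R by rewrite ltr0n.
set A0 := _ * zsum _.
pose I m := Rintegral nu `[0%R, 1%R] (fourier_harmonic delta q m n y).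
have ch m : continuous (fourier_harmonic delta q m n y) by exact: continuous_harmonic.
have I0 : I 0%N = A0.
  rewrite /I (_ : fourier_harmonic delta q 0 n y = fun=> A0).
    by rewrite Rintegral_cst // nu1 /= mulr1.
  apply/funext => t; rewrite /fourier_harmonic; congr (_ * zsum _); apply/funext => s.
  by rewrite mulr0 mul0r cos0 mulr1.
have -> : Rintegral nu `[0%R, 1%R] (fun t => fejer_approx w delta M q (n%:R * t - y)) =
    M%:R^-1 * \sum_(0 <= l < M) \sum_(0 <= l' < M) I (natdist l l').
  under eq_Rintegral do rewrite fejer_approx_harmonic //.
  have cs l : continuous (fun t => \sum_(0 <= l' < M) fourier_harmonic delta q (natdist l l') n y t).
    move=> t; apply: (@continuous_big _ _ _ _ _ _ _) => //; exact: add_continuous.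
  rewrite RintegralZl //; last first.
    apply: (continuous_itv01_integrable nu1) => t.
    by apply: (@continuous_big _ _ _ _ _ _ _) => //; exact: add_continuous.
  congr (_ * _); rewrite (Rintegral_itv01_sum nu1) //; apply: eq_bigr => l _.
  by rewrite (Rintegral_itv01_sum nu1).
pose h m := 16 * (B + 1) * delta * (Num.min 1 ((delta * m%:R) ^- 2) * abs_fourier nu (n * m)%:R).
have b0 := B0.
have h0 m : 0 <= h m.
  rewrite mulr_ge0 //; first by rewrite mulr_ge0 ?(ltW d0) //; lra.
  rewrite mulr_ge0 ?abs_fourier_ge0 // le_min ler01 invr_ge0 exprn_ge0 //.
  by rewrite mulr_ge0 // ltW.
have -> : M%:R^-1 * \sum_(0 <= l < M) \sum_(0 <= l' < M) I (natdist l l') - A0 =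
    M%:R^-1 * \sum_(0 <= l < M) \sum_(0 <= l' < M | l' != l) I (natdist l l').
  have -> : A0 = M%:R^-1 * \sum_(0 <= l < M) A0.
    by rewrite sumr_const_nat subn0 -[A0 *+ M]mulr_natr mulrCA mulVf ?mulr1 ?gt_eqF.
  rewrite -mulrBr -sumrB; congr (_ * _); apply: eq_big_nat => l lM.
  rewrite (bigD1_seq l) ?iota_uniq ?mem_index_iota //=.
  by rewrite {1}/natdist subnn addn0 I0 addrAC subrr add0r.
rewrite normrM normfV (gtr0_norm MR) ler_pdivrMl //.
apply: le_trans (ler_norm_sum _ _ _) _.
apply: (@le_trans _ _ (\sum_(0 <= l < M) 2 * \sum_(1 <= m < M) h m)); last first.
  rewrite sumr_const_nat subn0 -[_ *+ M]mulr_natl ler_wpM2l // /h -mulr_sumr.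
  by set S := \sum_(_ <= _ < _) _; lra.
apply: ler_sum_nat => l /andP[_ lM].
apply: le_trans (sum_natdist_le lM h0).
apply: le_trans (ler_norm_sum _ _ _) _.
rewrite [leLHS]big_nat_cond [leRHS]big_nat_cond.
apply: ler_sum => l' /andP[/andP[_ l'M] nl].
by apply: norm_Rintegral_harmonic_le => //; rewrite /natdist; lia.
Qed.

Definition lattice_sum y d (n : nat) t : R :=
  zsum (fun a => w ((t - (a%:~R + y) / n%:R) / d)).

Lemma lattice_sumE y d n t : (0 < n)%N -> 0 < d ->
  lattice_sum y d n t = periodization w (n%:R * d) (n%:R * t - y).
Proof.
move=> n0 d0; congr zsum; apply/funext => a; congr w.
by field; rewrite gt_eqF // pnatr_eq0; lia.
Qed.

Lemma continuous_lattice_sum y d n : (0 < n)%N -> 0 < d ->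
  continuous (lattice_sum y d n).
Proof.
move=> n0 d0.
have -> : lattice_sum y d n = (fun t => periodization w (n%:R * d) (n%:R * t - y)).
  by apply/funext => t; exact: lattice_sumE.
move=> t; apply: (@continuous_comp _ _ _ (fun t : R => n%:R * t - y)).
  by apply: cvgB; [apply: cvgMr; exact: cvg_id|exact: cvg_cst].
by apply: (continuous_periodization w_supp B0 w_lip); rewrite mulr_gt0 ?ltr0n.
Qed.

(** [A] and [M] are chosen before [nu], so that [A] cancels when [nu] is compared with Lebesgue
    measure. *)
Lemma lattice_sum_equidistribution y d n e : (0 < n)%N -> 0 < d -> 0 < e ->
  exists A (M : nat), `|A| <= 6 * (n%:R * d) /\
  forall nu, nu `[0%R, 1%R]%classic = 1%E ->
  `|Rintegral nu `[0%R, 1%R] (lattice_sum y d n) - A| <=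
  e + 32 * (B + 1) * (n%:R * d) *
    \sum_(1 <= m < M) (Num.min 1 ((d * (n * m)%:R) ^- 2) * abs_fourier nu (n * m)%:R).
Proof.
move=> n0 d0 e0; set delta := n%:R * d.
have dl0 : 0 < delta by rewrite mulr_gt0 ?ltr0n.
have [M M0 hM] := fejer_approx_unif w_supp B0 w_lip dl0 e0.
(* The first summand makes the coefficient bound available for all frequencies below [M]; the second
   ensures [q delta >= 1]. *)
pose q := (2 * M + (Num.truncn delta^-1).+1)%N.
have qd : 1 <= q%:R * delta.
  rewrite -ler_pdivrMr // div1r; apply: ltW; apply: lt_le_trans (truncnS_gt _) _.
  by rewrite ler_nat /q leq_addl.
have q0 : (0 < q)%N by rewrite /q; lia.
exists (q%:R^-1 * zsum (fun s => w (s%:~R / (q%:R * delta)))), M; split.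
  exact: (norm_mean_coeff_le w_range w_supp).
move=> nu nu1.
have cP : continuous (fun t => fejer_approx w delta M q (n%:R * t - y)).
  have -> : (fun t => fejer_approx w delta M q (n%:R * t - y)) = (fun t =>
     M%:R^-1 * \sum_(0 <= l < M) \sum_(0 <= l' < M) fourier_harmonic delta q (natdist l l') n y t).
    by apply/funext => t; exact: fejer_approx_harmonic.
  move=> t; apply: cvgM; first exact: cvg_cst.
  apply: (@continuous_big _ _ _ _ _ _ _) => [|i _].
    exact: add_continuous.
  move=> {}t; apply: (@continuous_big _ _ _ _ _ _ _) => [|j _].
    exact: add_continuous.
  exact: continuous_harmonic.
have cF := @continuous_lattice_sum y d n n0 d0.
have h1 : `|Rintegral nu `[0%R, 1%R] (lattice_sum y d n) -
   Rintegral nu `[0%R, 1%R] (fun t => fejer_approx w delta M q (n%:R * t - y))| <= e.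
  rewrite -RintegralB //; [|exact: continuous_itv01_integrable..].
  apply: (Rintegral_itv01_norm_le nu1); first by move=> t; apply: cvgB; [exact: cF|exact: cP].
  by move=> t _; rewrite distrC -/(lattice_sum y d n t) lattice_sumE // hM // /q; lia.
have h2 := @Rintegral_fejer_approx_dist nu delta M q n y nu1 M0 dl0 (leq_addr _ _) qd.
apply: le_trans (ler_distD (Rintegral nu `[0%R, 1%R] (fun t => fejer_approx w delta M q (n%:R * t - y))) _ _) _.
apply: lerD => //; apply: le_trans h2 _; rewrite le_eqVlt; apply/orP; left; apply/eqP.
congr (_ * _); apply: eq_bigr => m _; congr (Num.min _ (_ ^- _) * _).
by rewrite /delta natrM; ring.
Qed.

End OneDimensional.

(** * Sums over products and divisor multiplicities *)

Section DivisorSum.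
Variable R : realType.
Implicit Type f : nat -> R.

Lemma sum_multiples_le f (n M X : nat) : (forall x, 0 <= f x) -> (0 < n)%N -> (n * M <= X)%N ->
  \sum_(1 <= m < M) f (n * m)%N <= \sum_(1 <= x < X.+1) (n %| x)%:R * f x.
Proof.
move=> f0 n0 nMX.
have t0 x : 0 <= (n %| x)%:R * f x by rewrite mulr_ge0.
apply: (@le_trans _ _ (\sum_(1 <= x < n * M) (n %| x)%:R * f x)); last first.
  have [M0|M0] := leqP 1 (n * M); last by rewrite big_geq ?sumr_ge0 //; lia.
  by rewrite [leRHS](@big_cat_nat _ _ _ (n * M)) //= ?lerDl ?sumr_ge0 //; lia.
elim: M {nMX} => [|[|M] IH]; [by rewrite big_geq ?sumr_ge0..|].
rewrite big_nat_recr //= [leRHS](@big_cat_nat _ _ _ (n * M.+1)) /=; [|by lia..].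
apply: lerD => //; rewrite big_ltn; last by lia.
by rewrite dvdn_mulr // mul1r lerDl sumr_ge0.
Qed.

Lemma sum_dvdn_le_divisors (N x : nat) : (0 < N)%N -> (0 < x)%N ->
  \sum_(N <= n < 2 * N) (n %| x)%:R <= (size (divisors x))%:R :> R.
Proof.
move=> N0 x0; rewrite -natr_sum ler_nat.
rewrite -big_mkcond /= sum1_count -size_filter; apply: uniq_leq_size.
  by rewrite filter_uniq // iota_uniq.
by move=> n; rewrite mem_filter -dvdn_divisors // => /andP[].
Qed.

(** Grouped by [x = n m], each [x] occurs at most once per divisor [n]. The cutoffs [M n] are
    arbitrary, since those of the approximation vary with [n]. *)
Lemma sum_hyperbola_le f (N : nat) (M : nat -> nat) : (forall x, 0 <= f x) -> (0 < N)%N ->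
  exists X : nat, \sum_(N <= n < 2 * N) \sum_(1 <= m < M n) f (n * m)%N <=
    \sum_(1 <= x < X.+1) (size (divisors x))%:R * f x.
Proof.
move=> f0 N0; pose X := (\sum_(N <= n < 2 * N) n * M n)%N; exists X.
apply: (@le_trans _ _ (\sum_(N <= n < 2 * N) \sum_(1 <= x < X.+1) (n %| x)%:R * f x)).
  apply: ler_sum_nat => n nN; apply: sum_multiples_le => //; first by lia.
  by rewrite /X (bigD1_seq n) ?iota_uniq ?mem_index_iota //= leq_addr.
rewrite exchange_big_nat /=; apply: ler_sum_nat => x /andP[x1 _].
by rewrite -mulr_suml ler_wpM2r // sum_dvdn_le_divisors.
Qed.

End DivisorSum.

(** * The discrepancy in one coordinate, summed over n *)

Section OneDimensionalSum.
Variables (R : realType) (w : R -> R).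
Hypothesis w_smooth : smooth w.
Hypothesis w_range : forall x, 0 <= w x <= 1.
Hypothesis w_supp : forall x, 2 < `|x| -> w x = 0.

(** In the telescoped product, the first bound handles the factor that changes; both together bound
    the remaining factors. *)
Lemma sum_discrepancy_le (nu : {measure set (measurableTypeR R) -> \bar R}) (eps : R) :
  nu `[0%R, 1%R]%classic = 1%E -> 0 < eps ->
  exists2 C : R, 0 <= C & forall (N : nat) (y d : R), 0 < d <= 2^-1 ->
    let I n := Rintegral nu `[0%R, 1%R] (lattice_sum w y d n) in
    let J n := Rintegral (@lebesgue_measure R) `[0%R, 1%R] (lattice_sum w y d n) in
    \sum_(N <= n < 2 * N) `|I n - J n| <= C * N%:R * d `^ (l1dim nu - eps) /\
    forall n, (N <= n < 2 * N)%N -> `|J n| <= C * N%:R * d `^ (l1dim nu - eps).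
Proof.
move=> nu1 eps0.
have [B [B0 w_lip w_diff2]] := smooth_bump_regular w_smooth w_supp.
(* [e1] is lost twice, in approximating the dimension by [s] and in the divisor bound; the cap 1/2
   is what the dyadic lemma asks for. *)
pose e1 : R := Num.min (eps / 2) 2^-1.
have e10 : 0 < e1 by rewrite lt_min divr_gt0 //= invr_gt0 ltr0n.
have [e1e e12] : e1 <= eps / 2 /\ e1 <= 2^-1 by split; rewrite ge_min lexx ?orbT.
have [s [C1 [s0 hs hC1]]] := l1dim_approx nu1 e10.
have [D D0 hD] := @divisor_bound R e1 e10.
have C10 : 1 <= C1.
  have := hC1 1 (lexx _); rewrite powR1 mulr1; apply: le_trans.
  exact: one_le_l1_fourier_sum.
pose K := 32 * (B + 1).
have K0 : 0 <= K by rewrite /K; lra.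
have KDC : 0 <= 64 * K * D * C1 by rewrite !mulr_ge0 //; lra.
exists (64 * K * D * C1 + 12 * C1); first by lra.
move=> N y d hd I J; have /andP[d0 d2] := hd.
have [N0|N0] := posnP N.
  by subst N; rewrite muln0 big_geq // mulr0 mul0r; split => // n; rewrite andbC ltn0.
have NR : 1 <= N%:R :> R by rewrite ler1n.
have dpow : d `^ (s - e1) <= d `^ (l1dim nu - eps).
  by apply: ger_powR; [apply/andP; split => //; lra|lra].
(* The growth bound at [Q = d^-1], for a sum that is at least 1, gives [d <= C1 d ^ s]; this absorbs
   the main term [O(N d)] of [J n]. *)
have dle : d <= C1 * d `^ (l1dim nu - eps).
  have Q1 : 1 <= d^-1 by rewrite -invr1 lef_pV2 ?posrE //; lra.
  have h1 := le_trans (one_le_l1_fourier_sum nu1 _) (hC1 _ Q1).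
  have h2 : d^-1 `^ (1 - s) = d `^ s / d.
    rewrite -(powR_inv1 (ltW d0)) -powRrM -powRD ?(gt_eqF d0) ?implybT //.
    by congr (_ `^ _); ring.
  rewrite h2 mulrA ler_pdivlMr // mul1r in h1.
  apply: le_trans h1 _; rewrite ler_wpM2l //; first by lra.
  apply: ger_powR; [apply/andP; split => //; lra|lra].
set P := d `^ (l1dim nu - eps) in dpow dle *.
have P0 : 0 <= P by exact: powR_ge0.
pose f (x : nat) := Num.min 1 ((d * x%:R) ^- 2) * abs_fourier nu x%:R.
have f0 x : 0 <= f x.
  rewrite mulr_ge0 ?abs_fourier_ge0 // le_min ler01 invr_ge0 exprn_ge0 //.
  by rewrite mulr_ge0 // ltW.
(* The cutoffs depend on [e] but the final constants do not, so [e] can be taken arbitrarily small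
   at the end. *)
have approx e : 0 < e -> exists M : nat -> nat, forall n, (N <= n < 2 * N)%N ->
    `|I n - J n| <= 2 * e + K * (n%:R * d) * \sum_(1 <= m < M n) f (n * m)%N /\
    `|J n| <= e + 6 * (n%:R * d).
  move=> e0.
  have /choice[M hM] : forall n, exists M : nat, (N <= n < 2 * N)%N ->
     `|I n - J n| <= 2 * e + K * (n%:R * d) * \sum_(1 <= m < M) f (n * m)%N /\
     `|J n| <= e + 6 * (n%:R * d).
    move=> n; have [hn|hn] := boolP (N <= n < 2 * N)%N; last by exists 0%N.
    have n0 : (0 < n)%N by case/andP: hn => hn _; exact: leq_trans hn.
    have [A [M [hA hM]]] := lattice_sum_equidistribution w_range w_supp B0 w_lip w_diff2 y n0 d0 e0.
    exists M => _; have hI := hM nu nu1; have hJ := hM _ (@lebesgue_measure_itv01 R).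
    rewrite [X in _ + _ * X]big1_seq ?mulr0 ?addr0 in hJ; last first.
      move=> m; rewrite mem_index_iota => /andP[_ /andP[m1 _]].
      by rewrite abs_fourier_lebesgue ?mulr0 // muln_gt0 n0 m1.
    split.
      apply: le_trans (ler_distD A _ _) _; rewrite (distrC A).
      by apply: le_trans (lerD hI hJ) _; rewrite /K; set S := \sum_(_ <= _ < _) _; lra.
    have -> : J n = (J n - A) + A by ring.
    exact: le_trans (ler_normD _ _) (lerD hJ hA).
  by exists M.
have nle (n : nat) : (N <= n < 2 * N)%N -> n%:R * d <= 2 * N%:R * d.
  by move=> /andP[_ /ltnW hn]; rewrite ler_wpM2r ?(ltW d0) // -natrM ler_nat.
split.
  apply/ler_addgt0Pr => e e0.
  (* Each of the [N] values of [n] incurs twice this error, [e] in total. *)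
  have e20 : 0 < e / (2 * N%:R) by rewrite divr_gt0 // mulr_gt0 //; lra.
  have [M hM] := approx _ e20.
  have [X hX] := sum_hyperbola_le M f0 N0.
  (* [size (divisors x) <= D x ^ e1] turns the multiplicity into the weight of the dyadic bound. *)
  have hT : \sum_(1 <= x < X.+1) (size (divisors x))%:R * f x <= D * (32 * C1 * d `^ (s - e1 - 1)).
    have hd1 : 0 < d <= 1 by apply/andP; split => //; lra.
    have he1 : 0 < e1 <= 2^-1 by rewrite e10.
    have a0 (x : nat) : 0 <= abs_fourier nu x%:R by exact: abs_fourier_ge0.
    have := weighted_sum_le X a0 s0 hd1 he1
      (fun Q Q1 => le_trans (sum_abs_fourier_le nu Q) (hC1 Q Q1)).
    move=> h; apply: le_trans (ler_wpM2l D0 h); rewrite mulr_sumr.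
    apply: ler_sum_nat => x /andP[x1 _]; rewrite /f !mulrA ler_wpM2r // ler_wpM2r ?hD //.
    by rewrite le_min ler01 invr_ge0 exprn_ge0 // mulr_ge0 // ltW.
  apply: (@le_trans _ _ (\sum_(N <= n < 2 * N) (2 * (e / (2 * N%:R)) +
     K * (2 * N%:R * d) * \sum_(1 <= m < M n) f (n * m)%N))).
    apply: ler_sum_nat => n hn; apply: le_trans (hM n hn).1 _; rewrite lerD2l.
    by rewrite ler_wpM2r ?sumr_ge0 // ler_wpM2l // nle.
  rewrite big_split /= sumr_const_nat -mulr_sumr.
  have -> : (2 * N - N = N)%N by rewrite mul2n -addnn addnK.
  have -> : 2 * (e / (2 * N%:R)) *+ N = e.
    by rewrite -[_ *+ N]mulr_natr; field; rewrite pnatr_eq0 -lt0n.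
  rewrite addrC lerD2r.
  have Nd0 : 0 <= K * (2 * N%:R * d) by rewrite mulr_ge0 // mulr_ge0 ?(ltW d0) // mulr_ge0.
  apply: le_trans (ler_wpM2l Nd0 (le_trans hX hT)) _.
  have dE : d * d `^ (s - e1 - 1) = d `^ (s - e1).
    by rewrite -{1}(powRr1 (ltW d0)) -powRD ?(gt_eqF d0) ?implybT //; congr (_ `^ _); ring.
  have -> : K * (2 * N%:R * d) * (D * (32 * C1 * d `^ (s - e1 - 1))) =
     64 * K * D * C1 * N%:R * (d * d `^ (s - e1 - 1)) by ring.
  rewrite dE; apply: (@le_trans _ _ (64 * K * D * C1 * N%:R * P)).
    by rewrite ler_wpM2l // mulr_ge0.
  rewrite ler_wpM2r // ler_wpM2r //; lra.
move=> n hn; apply/ler_addgt0Pr => e e0.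
have [M hM] := approx _ e0.
apply: le_trans (hM n hn).2 _; rewrite addrC lerD2r.
have := nle n hn => h.
apply: (@le_trans _ _ (12 * C1 * N%:R * P)).
  apply: (@le_trans _ _ (12 * N%:R * d)); first by lra.
  have -> : 12 * C1 * N%:R * P = 12 * N%:R * (C1 * P) by ring.
  by rewrite ler_wpM2l //; lra.
rewrite ler_wpM2r // ler_wpM2r //; lra.
Qed.

End OneDimensionalSum.

(** * Several coordinates *)

Section ProductStructure.
Variable R : realType.

(** One finite window [W] contains the supports of all coordinates. The product of finite sums
    expands over functions into [W], coded by positions and decoded by [phi]; any [a] leaving [W]
    has a zero factor. *)
Lemma prod_zsum (k : nat) (F : nat -> int -> R) (c r : nat -> R) :
  (forall j, (j < k)%N -> 0 <= r j) ->
  (forall j s, (j < k)%N -> 0 <= F j s) ->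
  (forall j s, (j < k)%N -> r j < `|c j - s%:~R| -> F j s = 0) ->
  (\esum_(a in [set: {ffun 'I_k -> int}]) (\prod_(j < k) F j (a j))%:E)%E =
  (\prod_(j < k) zsum (F j))%:E.
Proof.
move=> r0 F0 Fs.
pose W : seq int := undup (flatten [seq zball (c j) (r j) | j <- iota 0 k]).
have uW : uniq W by exact: undup_uniq.
have FW (j : 'I_k) s : s \notin W -> F j s = 0.
  move=> /negP hs; apply: Fs => //; rewrite ltNge; apply/negP => h; apply: hs.
  rewrite mem_undup; apply/flatten_mapP; exists (j : nat); first by rewrite mem_iota leq0n add0n ltn_ord.
  by apply: mem_zball => //; exact: r0.
pose L := size W.
have -> : \prod_(j < k) zsum (F j) =
    \sum_(f : {ffun 'I_k -> 'I_L}) \prod_(j < k) F j (nth 0 W (f j)).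
  rewrite -(bigA_distr_bigA (fun (j : 'I_k) (i : 'I_L) => F j (nth 0 W i))).
  apply: eq_bigr => j _; rewrite (zsumE uW (FW j)).
  by rewrite (big_nth 0) big_mkord.
pose phi (f : {ffun 'I_k -> 'I_L}) : {ffun 'I_k -> int} := [ffun j => nth 0 W (f j)].
have phi_inj : injective phi.
  move=> f g /ffunP fg; apply/ffunP => j; have := fg j; rewrite !ffunE => /eqP.
  by rewrite nth_uniq ?ltn_ord // => /eqP/val_inj.
have -> : (\esum_(a in [set: {ffun 'I_k -> int}]) (\prod_(j < k) F j (a j))%:E)%E =
    (\esum_(a in range phi) (\prod_(j < k) F j (a j))%:E)%E.
  rewrite [RHS]esum_mkcond; apply: eq_esum => a _; case: ifPn => // /negP ha.
  have [j hj] : exists j, a j \notin W.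
    apply: contrapT => hn; apply: ha; rewrite inE.
    have hW j : a j \in W by apply: contrapT => h; apply: hn; exists j; apply/negP.
    have hi j : (index (a j) W < L)%N by rewrite index_mem.
    exists [ffun j => Ordinal (hi j)] => //.
    by apply/ffunP => j; rewrite !ffunE /= nth_index.
  by rewrite (bigD1 j) //= FW // mul0r.
rewrite (@reindex_esum _ _ _ [set: {ffun 'I_k -> 'I_L}] _ phi); last first.
  apply: inj_bij; move=> f g _ _; exact: phi_inj.
rewrite esum_fset; [|exact: finite_finset|]; last first.
  by move=> f _; rewrite lee_fin; apply: prodr_ge0 => j _; exact: F0.
rewrite (fsbigE (index_enum _)) ?index_enum_uniq //; last by move=> i _; rewrite mem_index_enum.
rewrite -sumEFin; apply: congr_big => // f; first by rewrite in_setT.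
by move=> _; congr EFin; apply: eq_bigr => j _; rewrite ffunE.
Qed.

Lemma Astar_prod (k : nat) (w : R -> R) (y d : nat -> R) (n : nat) (x : nat -> R) :
  (forall t, 0 <= w t <= 1) -> (forall t, 2 < `|t| -> w t = 0) ->
  (0 < n)%N -> (forall j, (j < k)%N -> 0 < d j) ->
  Astar k w y d n x = (\prod_(j < k) lattice_sum w (y j) (d j) n (x j))%:E.
Proof.
move=> w_range w_supp n0 d0; have nR : 0 < n%:R :> R by rewrite ltr0n.
rewrite /Astar (@prod_zsum k (fun j s => w ((x j - (s%:~R + y j) / n%:R) / d j))
  (fun j => n%:R * x j - y j) (fun j => 2 * (n%:R * d j))) //.
- by move=> j jk; rewrite !mulr_ge0 // ltW // d0.
- by move=> j s _; have /andP[] := w_range ((x j - (s%:~R + y j) / n%:R) / d j).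
- move=> j s jk h; have dj := d0 j jk; apply: w_supp.
  have -> : (x j - (s%:~R + y j) / n%:R) / d j = (n%:R * x j - y j - s%:~R) / (n%:R * d j).
    by field; rewrite !gt_eqF.
  have nd : 0 < n%:R * d j by rewrite mulr_gt0.
  by rewrite normrM normfV (gtr0_norm nd) ltr_pdivlMr.
Qed.

(** The innermost integral is over the last coordinate; its value is absorbed into [c], which is why
    the induction carries a general [c]. *)
Lemma iter_int_prod (mu : nat -> {measure set (measurableTypeR R) -> \bar R}) (m : nat)
    (F : nat -> R -> R) (c : R) (x : nat -> R) :
  (forall j, (j < m)%N -> mu j `[0%R, 1%R]%classic = 1%E) ->
  (forall j, (j < m)%N -> continuous (F j)) ->
  iter_int mu m (fun x => (c * \prod_(j < m) F j (x j))%:E) x =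
  (c * \prod_(j < m) Rintegral (mu j) `[0%R, 1%R] (F j))%:E.
Proof.
elim: m c x => [|m IH] c x mu1 cF; first by rewrite /= !big_ord0.
rewrite /= [in RHS]big_ord_recr /= [X in _ = (c * X)%:E]mulrC mulrA -(IH _ x); first last.
- by move=> j jm; apply: cF; rewrite ltnS ltnW.
- by move=> j jm; apply: mu1; rewrite ltnS ltnW.
congr iter_int; apply/funext => z.
have hi := continuous_itv01_integrable (mu1 m (ltnSn m)) (cF m (ltnSn m)).
transitivity (\int[mu m]_(t in `[0%R, 1%R]) ((c * \prod_(j < m) F j (z j))%:E * (F m t)%:E))%E.
  apply: eq_integral => t _; rewrite -EFinM big_ord_recr /= eqxx mulrA.
  congr (_ * _ * _)%:E; apply: eq_bigr => j _.
  by rewrite (ltn_eqF (ltn_ord j)).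
rewrite integralZl //= -[X in (_ * X)%E]fineK; last exact: integrable_fin_num.
by rewrite -EFinM; congr EFin; rewrite mulrAC.
Qed.

(** The factors are exchanged one at a time: the changed factor uses the summed bound, the others
    the pointwise ones, and each of the [k] exchanges costs at most the product of the [P j]. *)
Lemma sum_prod_diff_le (k : nat) (r : seq nat) (I J : nat -> nat -> R) (P : nat -> R) :
  (forall j, (j < k)%N -> \sum_(n <- r) `|I n j - J n j| <= P j) ->
  (forall j n, (j < k)%N -> n \in r -> `|I n j| <= P j /\ `|J n j| <= P j) ->
  \sum_(n <- r) `|\prod_(j < k) I n j - \prod_(j < k) J n j| <= k%:R * \prod_(j < k) P j.
Proof.
elim: k => [|k IH] hS hP.
  by rewrite mul0r big1 // => n _; rewrite !big_ord0 subrr normr0.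
have hP' j n : (j < k)%N -> n \in r -> `|I n j| <= P j /\ `|J n j| <= P j.
  by move=> jk; apply: hP; rewrite ltnS ltnW.
have IH' := IH (fun j jk => hS j (ltnW jk)) hP'.
have Pk0 : 0 <= P k by apply: le_trans (hS k (ltnSn k)); exact: sumr_ge0.
apply: (@le_trans _ _ (\sum_(n <- r) (P k * `|\prod_(j < k) I n j - \prod_(j < k) J n j| +
    `|I n k - J n k| * \prod_(j < k) P j))).
  rewrite [leLHS]big_seq [leRHS]big_seq; apply: ler_sum => n nr; rewrite !big_ord_recr /=.
  have -> : \prod_(j < k) I n j * I n k - \prod_(j < k) J n j * J n k =
    I n k * (\prod_(j < k) I n j - \prod_(j < k) J n j) + (I n k - J n k) * \prod_(j < k) J n j.
    by ring.
  apply: le_trans (ler_normD _ _) _; rewrite !normrM; apply: lerD.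
    by rewrite ler_wpM2r // (hP k n _ nr).1.
  rewrite ler_wpM2l // normr_prod; apply: ler_prod => j _.
  by rewrite normr_ge0 (hP' j n _ nr).2.
rewrite big_split /= -mulr_sumr -mulr_suml big_ord_recr /=.
have Q0 : 0 <= \prod_(j < k) P j.
  apply: prodr_ge0 => j _; apply: le_trans (hS j _); first exact: sumr_ge0.
  by rewrite ltnS ltnW.
have := ler_wpM2l Pk0 IH'; have := ler_wpM2r Q0 (hS k (ltnSn k)).
rewrite -natr1; set Q := \prod_(j < k) P j; lra.
Qed.

End ProductStructure.

Unset Implicit Arguments.

Theorem theorem3p1 (R : realType) (k : nat) (w : R -> R)
  (w_smooth : smooth w)
  (w_range : forall x, 0 <= w x <= 1)
  (w_supp : forall x, 2 < `|x| -> w x = 0)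
  (w_nz : exists x, w x != 0)
  (mu : nat -> probability (measurableTypeR R) R) (kappa : nat -> R)
  (mu_supp : forall j, (j < k)%N -> mu j `[0%R, 1%R]%classic = 1%E)
  (mu_dim : forall j, (j < k)%N -> kappa j = l1dim (mu j))
  (eps : R) (eps_pos : 0 < eps) :
  exists C : R, forall (N : nat) (y d : nat -> R),
    (forall j, (j < k)%N -> 0 < d j <= 2^-1) ->
    `| \sum_(N <= n < 2 * N)
         (fine (prod_int (fun j => mu j) k (Astar k w y d n))
          - fine (leb_int k (Astar k w y d n))) |
    <= C * (N%:R `^ (k%:R + eps)) * \prod_(j < k) (d j `^ (kappa j - eps)).
Proof.
have /choice[C hC] : forall j, exists C : R, (j < k)%N -> 0 <= C /\
   forall (N : nat) (y d : R), 0 < d <= 2^-1 ->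
    let I n := Rintegral (mu j) `[0%R, 1%R] (lattice_sum w y d n) in
    let J n := Rintegral (@lebesgue_measure R) `[0%R, 1%R] (lattice_sum w y d n) in
    \sum_(N <= n < 2 * N) `|I n - J n| <= C * N%:R * d `^ (kappa j - eps) /\
    forall n, (N <= n < 2 * N)%N -> `|J n| <= C * N%:R * d `^ (kappa j - eps).
  move=> j; have [jk|jk] := boolP (j < k)%N; last by exists 0.
  have [C C0 hC] := sum_discrepancy_le w_smooth w_range w_supp (mu_supp j jk) eps_pos.
  by exists C => _; split => //; rewrite (mu_dim j jk).
(* [k] counts the exchanges in the telescoping; the 2 comes from [|I| <= |I - J| + |J|]. *)
exists (k%:R * \prod_(j < k) (2 * C j)) => N y d hd.
have K0 : 0 <= \prod_(j < k) (2 * C j).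
  by apply: prodr_ge0 => j _; rewrite mulr_ge0 //; have [] := hC j (ltn_ord j).
have D0 : 0 <= \prod_(j < k) (d j `^ (kappa j - eps)).
  by apply: prodr_ge0 => j _; exact: powR_ge0.
have [N0|N0] := posnP N.
  by rewrite N0 muln0 big_geq // normr0 !mulr_ge0 ?powR_ge0.
pose I (n j : nat) := Rintegral (mu j) `[0%R, 1%R] (lattice_sum w (y j) (d j) n).
pose J (n j : nat) := Rintegral (@lebesgue_measure R) `[0%R, 1%R] (lattice_sum w (y j) (d j) n).
have [B [B0 w_lip w_diff2]] := smooth_bump_regular w_smooth w_supp.
have dj0 j : (j < k)%N -> 0 < d j by move=> /hd/andP[].
have prodE (nu : nat -> {measure set (measurableTypeR R) -> \bar R}) n : (0 < n)%N ->
    (forall j, (j < k)%N -> nu j `[0%R, 1%R]%classic = 1%E) ->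
    fine (prod_int nu k (Astar k w y d n)) =
    \prod_(j < k) Rintegral (nu j) `[0%R, 1%R] (lattice_sum w (y j) (d j) n).
  move=> n0 nu1; rewrite /prod_int.
  have -> : Astar k w y d n =
      (fun x => (1 * \prod_(j < k) lattice_sum w (y j) (d j) n (x j))%:E).
    by apply/funext => x; rewrite mul1r; exact: Astar_prod.
  rewrite (@iter_int_prod _ nu k (fun j => lattice_sum w (y j) (d j) n)) ?mul1r //.
  move=> j jk; exact: (continuous_lattice_sum w_supp B0 w_lip n0 (dj0 j jk)).
have -> : \sum_(N <= n < 2 * N) (fine (prod_int (fun j => mu j) k (Astar k w y d n))
          - fine (leb_int k (Astar k w y d n))) =
    \sum_(N <= n < 2 * N) (\prod_(j < k) I n j - \prod_(j < k) J n j).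
  apply: eq_big_nat => n hn; have n0 : (0 < n)%N by case/andP: hn => hn _; exact: leq_trans hn.
  rewrite /leb_int !prodE // => j _; exact: lebesgue_measure_itv01.
apply: le_trans (ler_norm_sum _ _ _) _.
pose P j := 2 * C j * N%:R * d j `^ (kappa j - eps).
apply: le_trans (@sum_prod_diff_le R k _ I J P _ _) _.
- move=> j jk; have [C0 h] := hC j jk; have [h1 _] := h N (y j) (d j) (hd j jk).
  apply: le_trans h1 _; rewrite /P -!mulrA.
  by apply: ler_peMl; rewrite ?mulr_ge0 ?powR_ge0 // ler1n.
- move=> j n jk; rewrite mem_index_iota => hn; have [C0 h] := hC j jk.
  have [h1 h2] := h N (y j) (d j) (hd j jk).
  have hJ : `|J n j| <= C j * N%:R * d j `^ (kappa j - eps) := h2 n hn.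
  have hIJ : `|I n j - J n j| <= C j * N%:R * d j `^ (kappa j - eps).
    apply: le_trans h1.
    by rewrite (bigD1_seq n) ?iota_uniq ?mem_index_iota //= lerDl sumr_ge0.
  have PE : P j = C j * N%:R * d j `^ (kappa j - eps) + C j * N%:R * d j `^ (kappa j - eps).
    by rewrite /P; ring.
  split; rewrite PE.
    have -> : I n j = (I n j - J n j) + J n j by ring.
    exact: le_trans (ler_normD _ _) (lerD hIJ hJ).
  by apply: le_trans hJ _; rewrite lerDl; apply: le_trans (normr_ge0 _) hIJ.
have -> : \prod_(j < k) P j =
    \prod_(j < k) (2 * C j) * N%:R ^+ k * \prod_(j < k) (d j `^ (kappa j - eps)).
  by rewrite /P !big_split /= !prodr_const card_ord.
rewrite !mulrA ler_wpM2r // ler_wpM2l ?mulr_ge0 //.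
(* The divisor loss has gone into the powers of [d], which leaves [N ^ k <= N ^ (k + eps)]. *)
rewrite -powR_mulrn //; apply: ler_powR; first by rewrite ler1n.
by rewrite lerDl ltW.
Qed.
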